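(* Let $G$ be a general matchgate with input set $X$, omittable set $T$ and output set $Y$, and let $k=|X\cup Y|$. Then there exist two (planar) matchgates $G_1$ and $G_2$, each with $k$ external nodes, such that for all $\alpha\in\{0,1\}^k$, \[ \check{\chi}_G^\alpha=\Gamma_{G_1}^\alpha+\Gamma_{G_2}^\alpha . \]
   Context: A general matchgate is an undirected graph $G=(V,E)$ with complex edge weights (not necessarily planar), whose vertices carry distinct labels from a totally ordered set, together with three pairwise disjoint subsets $X$ (input nodes), $T$ (omittable nodes), $Y$ (output nodes) of $V$ such that every label in $X$ is smaller than every label in $T$, which is smaller than every label in $Y$. Its skew-symmetric matrix $M_G$ (rows/columns in increasing label order) has $(M_G)_{i,j}=w(\{i,j\})$ and $(M_G)_{j,i}=-w(\{i,j\})$ for $i<j$ (weight $0$ if there is no edge), and $\mathrm{Pf}(G)=\mathrm{Pf}(M_G)$, where for an $n\times n$ skew-symmetric $A$ with $n$ even $\mathrm{Pf}(A)=\sum_\pi\epsilon_\pi A_{i_1,i_2}\cdots A_{i_{n-1},i_n}$ over permutations with $i_1<i_2,\ldots$ and $i_1<i_3<\cdots$, $\epsilon_\pi$ the sign of $\pi$ ($\mathrm{Pf}$ of an empty matrix is $1$, of an odd-size matrix $0$). The Pfaffian Sum is $\mathrm{PfS}(G)=\sum_{W\subseteq T}\mathrm{Pf}(G-W)$, where $G-W$ deletes the vertices of $W$ and their incident edges. The external nodes are $X\cup Y$, listed in increasing label order $x_1<\cdots<x_k$; for $\alpha\in\{0,1\}^k$ let $Z_\alpha=\{x_i:\alpha_i=1\}$,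 and the naked character is $\check{\chi}_G^\alpha=\mathrm{PfS}(G-Z_\alpha)$ (with $T$ still the omittable set of $G-Z_\alpha$). A (planar) matchgate is an undirected graph with nonzero complex edge weights, given with a planar embedding, with $k$ external nodes on the outer face numbered $1,\ldots,k$ clockwise; its signature is $\Gamma^\alpha=\mathrm{PerfMatch}(H^\alpha)$, where $H^\alpha$ deletes each external node $i$ with $\alpha_i=1$ and its incident edges, and $\mathrm{PerfMatch}$ is the sum over perfect matchings of the product of edge weights. *)

(* Defs.v *)
From mathcomp Require Import all_boot all_order all_algebra all_fingroup.
From mathcomp Require Import complex.
From mathcomp Require Import reals.
Set Implicit Arguments. Unset Strict Implicit. Unset Printing Implicit Defensive.
Import Order.TTheory GRing.Theory Num.Theory.
Local Open Scope ring_scope.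

Lemma pf_ev_subproof (m : nat) (j : 'I_(m./2)) : (j.*2 < m)%N.
Proof.
have Hj := ltn_ord j.
have H2 : ((m./2).*2 <= m)%N by rewrite -{2}(odd_double_half m) leq_addl.
by apply: leq_trans H2; rewrite ltn_double.
Qed.

Lemma pf_od_subproof (m : nat) (j : 'I_(m./2)) : (j.*2.+1 < m)%N.
Proof.
have Hj := ltn_ord j.
have H2 : ((m./2).*2 <= m)%N by rewrite -{2}(odd_double_half m) leq_addl.
apply: leq_trans H2; rewrite -doubleS leq_double //.
Qed.

(* position 2j (0-based), i.e. i_{2j+1} in 1-based notation *)
Definition pf_ev (m : nat) (j : 'I_(m./2)) : 'I_m := Ordinal (pf_ev_subproof j).
(* position 2j+1 (0-based), i.e. i_{2j+2} in 1-based notation *)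
Definition pf_od (m : nat) (j : 'I_(m./2)) : 'I_m := Ordinal (pf_od_subproof j).

(* s encodes the permutation (i_1, ..., i_m): s (position) = value.
   Admissible: i_1 < i_2, i_3 < i_4, ...  and  i_1 < i_3 < i_5 < ... *)
Definition pf_admissible (m : nat) (s : 'S_m) : bool :=
  [forall j : 'I_(m./2), (s (pf_ev j) < s (pf_od j))%N] &&
  [forall j : 'I_(m./2), forall j' : 'I_(m./2),
      (j < j')%N ==> (s (pf_ev j) < s (pf_ev j'))%N].

Definition pfaffian (C : comNzRingType) (m : nat) (A : 'M[C]_m) : C :=
  if odd m then 0 else
  \sum_(s : 'S_m | pf_admissible s)
     (-1) ^+ s * \prod_(j < m./2) A (s (pf_ev j)) (s (pf_od j)).

(* Vertices are 'I_n with labels ordered as natural numbers; the edge  *)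
(* weight function w is symmetric (weight 0 = no edge).                *)

Definition skew_mx (C : comNzRingType) (n : nat) (w : 'I_n -> 'I_n -> C)
  : 'M[C]_n :=
  \matrix_(i, j) (if (i < j)%N then w i j
                  else if (j < i)%N then - w j i else 0).

(* Pf of the graph induced on the vertex set S (rows/cols in increasing
   label order: enum_val enumerates S increasingly). *)
Definition pf_on (C : comNzRingType) (n : nat) (w : 'I_n -> 'I_n -> C)
  (S : {set 'I_n}) : C :=
  pfaffian (\matrix_(i < #|S|, j < #|S|) skew_mx w (enum_val i) (enum_val j)).

Definition pf_del (C : comNzRingType) (n : nat) (w : 'I_n -> 'I_n -> C)
  (D : {set 'I_n}) : C := pf_on w (~: D).

Definition pfsum_del (C : comNzRingType) (n : nat) (w : 'I_n -> 'I_n -> C)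
  (T Z : {set 'I_n}) : C :=
  \sum_(W : {set 'I_n} | W \subset T) pf_del w (Z :|: W).

Definition Z_alpha (n : nat) (X Y : {set 'I_n}) (alpha : 'I_#|X :|: Y| -> bool)
  : {set 'I_n} := [set enum_val i | i in [pred i | alpha i]].

Definition naked_char (C : comNzRingType) (n : nat) (w : 'I_n -> 'I_n -> C)
  (X T Y : {set 'I_n}) (alpha : 'I_#|X :|: Y| -> bool) : C :=
  pfsum_del w T (Z_alpha alpha).
Arguments naked_char {C n} w X T Y alpha.

Definition general_matchgate (C : comNzRingType) (n : nat)
  (w : 'I_n -> 'I_n -> C) (X T Y : {set 'I_n}) : Prop :=
  (forall u v, w u v = w v u) /\
  [/\ [disjoint X & T], [disjoint T & Y], [disjoint X & Y],
      (forall x t, x \in X -> t \in T -> (x < t)%N) &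
      (forall t y, t \in T -> y \in Y -> (t < y)%N)].

Section Maps.
Variables (V : finType) (e : rel V).

Definition darts : {set V * V} := [set d | e d.1 d.2].

Definition is_rotation (r : {perm V * V}) : Prop :=
  (forall d, d \in darts -> r d \in darts /\ (r d).1 = d.1) /\
  (forall d d', d \in darts -> d' \in darts -> d.1 = d'.1 ->
      exists m : nat, (r ^+ m)%g d = d').

Definition face_step (r : {perm V * V}) (d : V * V) : V * V := r (d.2, d.1).

Definition num_faces (r : {perm V * V}) : nat :=
  #|[set [set d' | fconnect (face_step r) d d'] | d in darts]|.

Definition num_isolated : nat := #|[set u | [forall v, ~~ e u v]]|.

Definition num_components : nat := #|[set [set v | connect e u v] | u : V]|.

(* Euler's formula for every component (genus 0 everywhere):
   V - E + F = 2 C, faces counting an isolated vertex as one face,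
   written as 2V + 2F = 4C + #darts  (#darts = 2E). *)
Definition genus0 (r : {perm V * V}) : Prop :=
  (#|V|.*2 + (num_faces r + num_isolated).*2 = 4 * num_components + #|darts|)%N.

End Maps.

Definition aug_rel (n k : nat) (e : rel 'I_n) (ext : 'I_k -> 'I_n)
  : rel (option 'I_n) :=
  fun a b => match a, b with
  | Some u, Some v => e u v
  | None, Some v | Some v, None => v \in codom ext
  | None, None => false
  end.

(* G has a planar embedding with the external nodes ext 0, ..., ext (k-1)
   on the outer face in this cyclic order: equivalently, G + z has a genus-0
   rotation system whose rotation at z is ext 0 -> ext 1 -> ... -> ext 0. *)
Definition planar_outer (n k : nat) (e : rel 'I_n) (ext : 'I_k -> 'I_n) : Prop :=
  exists r : {perm option 'I_n * option 'I_n},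
    [/\ is_rotation (aug_rel e ext) r, genus0 (aug_rel e ext) r &
        forall i : 'I_k, r (None, Some (ext i)) = (None, Some (ext (ordS i)))].

Record pmatchgate (C : comNzRingType) (k : nat) := PMatchgate {
  pm_n : nat;
  pm_w : 'I_pm_n -> 'I_pm_n -> C;          (* 0 = no edge *)
  pm_ext : 'I_k -> 'I_pm_n;                (* external node i+1 *)
  pm_sym : forall u v, pm_w u v = pm_w v u;
  pm_irr : forall u, pm_w u u = 0;
  pm_ext_inj : injective pm_ext;
  pm_planar : planar_outer (fun u v => pm_w u v != 0) pm_ext }.

(* perfect matchings of the graph induced on S, as fixed-point-free
   involutions of S along edges (identity outside S) *)
Definition is_perfmatch (C : comNzRingType) (n : nat) (w : 'I_n -> 'I_n -> C)
  (S : {set 'I_n}) (mu : {ffun 'I_n -> 'I_n}) : bool :=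
  [forall u, if u \in S then
               [&& mu u \in S, mu u != u, mu (mu u) == u & w u (mu u) != 0]
             else mu u == u].

Definition perfmatch_on (C : comNzRingType) (n : nat) (w : 'I_n -> 'I_n -> C)
  (S : {set 'I_n}) : C :=
  \sum_(mu : {ffun 'I_n -> 'I_n} | is_perfmatch w S mu)
     \prod_(u in S | (u < mu u)%N) w u (mu u).

Definition signature (C : comNzRingType) (k : nat) (G : pmatchgate C k)
  (alpha : 'I_k -> bool) : C :=
  perfmatch_on (@pm_w _ _ G) (~: [set pm_ext G i | i in [pred i | alpha i]]).

(* Main.v *)
Require Import Defs.
From mathcomp Require Import all_boot all_order all_algebra all_fingroup.
From mathcomp Require Import complex reals.
From mathcomp Require Import zify ring.
Set Implicit Arguments. Unset Strict Implicit. Unset Printing Implicit Defensive.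

(* View the signature of a matchgate as a function of the set of deleted
   external nodes, and the external nodes as wires around the outer face.
   Three planar surgeries suffice to act on such functions: hang a new external
   node on the outer face, join two consecutive external nodes by an edge, and
   make the second of two adjacent consecutive external nodes internal. They
   generate bit flips, nearest-neighbour pair creation and hopping, and hence
   the fermionic swap, which exchanges two adjacent wires with a sign -1 when
   both nodes are present. Letting a new wire travel once around the others,
   swapping with and pairing to each in turn, reproduces the expansion of a
   Pfaffian along its first row; so every function Z |-> Pf(G - Z) is the
   signature of a planar matchgate in which all nodes are external.
   Internal nodes are then absorbed by their neighbours. As the omittable nodes
   are consecutive, they can be merged one after the other into a single parity
   wire, whose two values carry the sums over the W of even and of odd size:
   these are the two planar matchgates.

   Planarity is tracked on a fixed vertex set: each surgery multiplies the
   rotation system by transpositions, whose effect on the number of faces is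
   given by porbits_mul_tperm. *)

(** * Rotation systems *)

Section Permutations.
Local Open Scope group_scope.
Variable T : finType.
Implicit Types (r s : {perm T}) (x y : T) (B : {set T}).

Lemma porbit_fconnect s x y : fconnect s x y = (y \in porbit s x).
Proof.
apply/idP/porbitP => [/iter_findex <-|[i ->]]; last by rewrite permX fconnect_iter.
by exists (findex s x y); rewrite permX.
Qed.

Lemma porbit_apply s x y : (s y \in porbit s x) = (y \in porbit s x).
Proof. by rewrite !(porbit_sym s _ x) -(porbit_perm s 1 y) expg1. Qed.

Lemma porbitsT s : porbits s = porbit s @: setT.
Proof. by apply/setP=> O; apply/imsetP/imsetP => -[x _ ->]; exists x. Qed.

Lemma porbit_closed s B x :
  {in B, forall y, s y \in B} -> x \in B -> {subset porbit s x <= B}.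
Proof.
move=> sB xB y /porbitP[i ->]; rewrite permX.
by elim: i => //= i; apply: sB.
Qed.

Lemma eq_in_porbit r s B x :
    {in B, r =1 s} -> {in B, forall y, s y \in B} -> x \in B ->
  porbit r x = porbit s x.
Proof.
move=> rs sB xB.
have itB i : iter i s x \in B by elim: i => //= i; exact: sB.
have itE i : (r ^+ i) x = (s ^+ i) x.
  by rewrite !permX; elim: i => //= i ->; rewrite rs.
by apply/setP=> y; apply/porbitP/porbitP => -[i ->]; exists i.
Qed.

Lemma porbit2 s x y : s x = y -> s y = x -> porbit s x = [set x; y].
Proof.
move=> sx sy; apply/setP => z; apply/idP/idP; last first.
  by rewrite !inE => /orP[]/eqP->; rewrite -?sx ?porbit_apply porbit_id.
apply: porbit_closed; last by rewrite !inE eqxx.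
by move=> w; rewrite !inE => /orP[]/eqP->; rewrite ?sx ?sy eqxx ?orbT.
Qed.

Lemma card_porbits_tperm_notin s x y :
  x \notin porbit s y -> #|porbits (tperm x y * s)|.+1 = #|porbits s|.
Proof.
move=> xy; have := porbits_mul_tperm s x y; rewrite /= xy.
have -> : x != y by apply: contraNneq xy => ->; exact: porbit_id.
by lia.
Qed.

Lemma card_porbits_tperm_in s x y :
  x \in porbit s y -> x != y -> #|porbits (tperm x y * s)| = #|porbits s|.+1.
Proof.
by move=> xy nxy; have := porbits_mul_tperm s x y; rewrite /= xy nxy; lia.
Qed.

(** Surgeries put transpositions on the right of the face permutation, while
    [card_porbits_tperm_notin] and [card_porbits_tperm_in] want them on the left; this moves them
    across. *)
Lemma mul_tpermr s x y : s * tperm (s x) (s y) = tperm x y * s.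
Proof. by rewrite [RHS]conjgC tpermJ. Qed.

(* [r'] is [r] with the point [y] cut out of its cycle. *)
Lemma porbit_bypass r r' y x z :
    (forall d, d != y -> r' d = if r d == y then r y else r d) ->
    x != y -> z != y -> (z \in porbit r x) = (z \in porbit r' x).
Proof.
move=> r'E xy zy; apply/idP/idP; last first.
  case/porbitP=> i; rewrite permX => ->.
  suff: (iter i r' x != y) && (iter i r' x \in porbit r x) by case/andP.
  elim: i => [|i /= /andP[ny xi]]; first by rewrite xy porbit_id.
  rewrite r'E //; case: (eqVneq (r (iter i r' x)) y) => [e|->].
    rewrite -e !porbit_apply xi andbT; apply: contra ny => /eqP ry.
    by rewrite -e (perm_inj ry).
  by rewrite porbit_apply.
case/porbitP=> i; rewrite permX => zE.
suff: (if iter i r x == y then r y else iter i r x) \in porbit r' x.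
  by rewrite -zE (negPf zy).
elim: i {zE} => [|i] /=; first by rewrite (negPf xy) porbit_id.
case: eqVneq => [->|ny].
  by move=> h; case: ifP => [/eqP e|_]; rewrite ?e in h *.
by rewrite -porbit_apply r'E.
Qed.

(** A left factor [tperm x y] inserts the fixed point [y] into the cycle of [x] just after [x]; a
    right factor, as in [bypass_insr], inserts it just before [x]. The equations have the shape that
    [porbit_bypass] asks for. *)
Lemma bypass_insl r x y d : r y = y -> d != y ->
  r d = if (tperm x y * r) d == y then (tperm x y * r) y else (tperm x y * r) d.
Proof.
move=> ry dy; rewrite !permM tpermR; case: tpermP => [->|e|/eqP dx _].
- by rewrite ry eqxx.
- by rewrite e eqxx in dy.
- by rewrite -{1}ry (inj_eq perm_inj) (negPf dy).
Qed.

Lemma bypass_insr r x y d : r y = y -> d != y ->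
  r d = if (r * tperm x y) d == y then (r * tperm x y) y else (r * tperm x y) d.
Proof.
move=> ry dy; rewrite !permM ry tpermR; case: tpermP => [->|e|_ /eqP/negPf-> //].
- by rewrite eqxx.
- by move: dy; rewrite -(inj_eq (@perm_inj _ r)) ry e eqxx.
Qed.

Lemma bypass_out r y d : d != y ->
  (r * tperm y (r y)) d = if r d == y then r y else r d.
Proof.
move=> dy; rewrite permM; case: tpermP => [->|/perm_inj e|/eqP/negPf-> //].
- by rewrite eqxx.
- by rewrite e eqxx in dy.
Qed.

End Permutations.

Lemma sub_path_target (T : eqType) (R R' : rel T) x s :
  (forall y z, y \in s -> R z y -> R' z y) -> path R x s -> path R' x s.
Proof.
elim: s x => //= y s IH x RR /andP[xy ys]; rewrite (RR _ _ (mem_head _ _) xy).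
by apply: IH ys => z w zs; apply: RR; rewrite inE zs orbT.
Qed.

(** * Planar embeddings with an apex in the outer face, and surgeries on them *)

Section Planarity.
Local Open Scope group_scope.
Variable N : nat.
Notation V := (option 'I_N).
Implicit Types (e : rel 'I_N) (s : seq 'I_N) (A : {set 'I_N}) (r : {perm V * V}).

(** This is [aug_rel] with the external nodes given as a list: the apex [None], drawn in the outer
    face, is joined to each of them. *)
Definition star_rel e s : rel V := fun a b =>
  match a, b with
  | Some u, Some v => e u v
  | None, Some v | Some v, None => v \in s
  | None, None => false
  end.

Lemma star_rel_sym e s : symmetric e -> symmetric (star_rel e s).
Proof. by move=> se [a|] [b|] //=. Qed.

Definition dart_swap (d : V * V) := (d.2, d.1).

Lemma dart_swapK : involutive dart_swap. Proof. by case. Qed.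

Definition dswap : {perm V * V} := perm (can_inj dart_swapK).

Definition face_perm r := dswap * r.

Lemma face_permE r a b : face_perm r (a, b) = r (b, a).
Proof. by rewrite permM permE. Qed.

Lemma card_V : #|{: V}| = N.+1. Proof. by rewrite card_option card_ord. Qed.

(** Give a diagonal pair weight 2 and any other pair weight 1. Every orbit {d, [dart_swap d]} then
    has total weight 2, and the diagonal contributes the extra [N.+1]. *)
Lemma card_swap_porbits (phi : {perm V * V}) (B : {set V * V}) :
    (forall d, d \in B -> phi d = dart_swap d /\ dart_swap d \in B) ->
    (forall a, (a, a) \in B) ->
  #|porbit phi @: B|.*2 = #|B| + N.+1.
Proof.
move=> phiB diagB.
have fE d : d \in B -> porbit phi d = [set d; dart_swap d].
  move=> dB; have [pd sB] := phiB d dB; apply: porbit2 => //.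
  by have [-> _] := phiB _ sB; rewrite dart_swapK.
have : \sum_(d in B) (1 + (d.1 == d.2)) = #|porbit phi @: B|.*2.
  rewrite (partition_big_imset (porbit phi)) /= -muln2 -sum_nat_const.
  apply: eq_bigr => _ /imsetP[[a b] abB ->].
  have [_ baB] := phiB _ abB.
  rewrite (eq_bigl (fun d => d \in [set (a, b); (b, a)])); last first.
    move=> d; rewrite eq_porbit_mem fE //; apply: andb_idl.
    by rewrite !inE => /orP[]/eqP->.
  have [->|nab] := eqVneq a b; first by rewrite setUid big_set1 /= eqxx.
  rewrite big_setU1 /= ?big_set1 /= ?(eq_sym b) ?(negPf nab) //.
  by rewrite inE xpair_eqE (negPf nab).
rewrite big_split /= sum1_card => <-; congr (_ + _).
have -> : \sum_(d in B) (d.1 == d.2) = \sum_(d : V * V) (d.1 == d.2).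
  rewrite [RHS](bigID (mem B)) /= [X in _ = _ + X]big1 ?addn0 // => -[a b] /=.
  by case: eqP => // <-; rewrite diagB.
rewrite -(pair_bigA _ (fun i j : V => nat_of_bool (i == j))) /= -card_V -sum1_card.
apply: eq_bigr => i _.
by rewrite (bigD1 i) //= eqxx big1 // => j /negPf; rewrite eq_sym => ->.
Qed.

(* The vertices outside [A] are isolated reserves for later surgeries. Counting
   orbits on all of [V * V], where a pair of non-darts {d, dart_swap d} is an orbit
   too, turns Euler's formula into [pi_count], which does not mention the darts. *)
Record planar_inv e A s r : Prop := PlanarInv {
  pi_sym : symmetric e;
  pi_irr : irreflexive e;
  pi_act : forall u v, e u v -> u \in A;
  pi_uniq : uniq s;
  pi_sub : {subset s <= A};
  pi_src : forall d, (r d).1 = d.1;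
  pi_fix : forall d, ~~ star_rel e s d.1 d.2 -> r d = d;
  pi_rot : forall u a b, star_rel e s (Some u) a -> star_rel e s (Some u) b ->
             (Some u, b) \in porbit r (Some u, a);
  pi_cycle : path.cycle (fun x y => r (None, Some x) == (None, Some y)) s;
  pi_conn : forall a, a \in A -> connect (star_rel e s) None (Some a);
  pi_count : #|porbits (face_perm r)|.*2 + N.+1 + #|A|.*2
             = (N.+1 ^ 2 + N.+1.*2).+2 }.

Lemma planar_inv_rot e A s r k : planar_inv e A s r -> planar_inv e A (rot k s) r.
Proof.
case=> P1 P2 P3 P4 P5 P6 P7 P8 P9 P10 P11.
have E : star_rel e (rot k s) =2 star_rel e s.
  by move=> [u|] [v|] //=; rewrite mem_rot.
split=> //; rewrite ?rot_uniq ?rot_cycle //.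
- by move=> x; rewrite mem_rot; exact: P5.
- by move=> d; rewrite E; exact: P7.
- by move=> u a b; rewrite !E; exact: P8.
- by move=> a /P10; rewrite (eq_connect E).
Qed.

Lemma planar_inv_base e x : (forall u v, e u v = false) ->
  planar_inv e [set x] [:: x] 1.
Proof.
move=> e0; split=> //=.
- by move=> u v; rewrite !e0.
- by move=> u v; rewrite e0.
- by move=> y; rewrite !inE.
- by move=> d; rewrite perm1.
- by move=> d; rewrite perm1.
- by move=> u [a|] [b|] //=; rewrite ?e0 // => _ _; exact: porbit_id.
- by rewrite perm1 eqxx.
- by move=> a /set1P->; apply: connect1; rewrite /= inE.
(* With the identity as rotation, [face_perm] is the dart reversal on all pairs. *)
have := @card_swap_porbits dswap setT; rewrite -porbitsT.
rewrite cards1 /face_perm mulg1 cardsT card_prod card_V => -> //; first by rewrite -mulnn; lia.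
  by move=> d _; rewrite permE inE.
by move=> a; rewrite inE.
Qed.

(** The new spoke at [v] is inserted just before the one at [u] in the rotation at [None]. The
    non-dart orbit on [(None, Some v)] and [(Some v, None)] merges into a face; the loss of one
    orbit balances the growth of [A] by one vertex. *)
Lemma planar_inv_leaf e A u s r v :
    planar_inv e A (u :: s) r -> v \notin A ->
  planar_inv e (v |: A) [:: v, u & s] (r * tperm (None, Some u) (None, Some v)).
Proof.
case=> P1 P2 P3 P4 P5 P6 P7 P8 P9 P10 P11 vA.
set t := tperm _ _; set r' := r * t.
have vs : v \notin u :: s by apply: contra vA => /P5.
have rv : r (None, Some v) = (None, Some v) by exact: P7.
have fv : face_perm r (Some v, None) = (None, Some v) by rewrite face_permE.
have fv' : face_perm r (None, Some v) = (Some v, None) by rewrite face_permE P7.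
have sub a b : star_rel e (u :: s) a b -> star_rel e [:: v, u & s] a b.
  by case: a b => [a|] [b|] //= h; rewrite in_cons h orbT.
have r'E a d : r' (Some a, d) = r (Some a, d).
  rewrite permM; case E: (r _) => [c d']; have := P6 (Some a, d).
  by rewrite E /= => ->; rewrite tpermD // xpair_eqE.
split=> //.
- by move=> x y /P3; rewrite inE orbC => ->.
- by rewrite cons_uniq vs.
- by move=> x; rewrite inE => /predU1P[->|/P5]; rewrite !inE ?eqxx // orbC => ->.
- move=> d; rewrite permM -[RHS]P6; case: (r d) => [a b] /=.
  by rewrite /t; case: tpermP => // [] [-> _].
- move=> [a b] /= nd; rewrite permM P7; last by apply: contra nd => /sub.
  apply: tpermD; apply: contraNneq nd => -[<- <-] /=; first by rewrite !inE eqxx orbT.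
  by rewrite inE eqxx.
- move=> x a b xa xb.
  have -> : porbit r' (Some x, a) = porbit r (Some x, a).
    apply: (@eq_in_porbit _ _ _ [set d | d.1 == Some x]); last by rewrite inE.
      by move=> [? ?]; rewrite inE => /eqP/= ->; exact: r'E.
    by move=> d; rewrite !inE P6.
  have [xv|xv] := eqVneq x v.
    have ab c : star_rel e [:: v, u & s] (Some x) c -> c = None.
      by case: c => //= c; rewrite xv => /P3; rewrite (negPf vA).
    by rewrite (ab _ xa) (ab _ xb) porbit_id.
  have old c : star_rel e [:: v, u & s] (Some x) c -> star_rel e (u :: s) (Some x) c.
    by case: c => //=; rewrite inE (negPf xv).
  by apply: P8; apply: old.
- move: P9; rewrite /= permM rv tpermR eqxx /= !rcons_path.
  case/andP=> ps /eqP ls; rewrite permM ls tpermL eqxx andbT.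
  apply: sub_path_target ps => y x ys /eqP xy; rewrite permM xy tpermD //.
    by apply: contraTneq P4 => -[->]; rewrite /= ys.
  by apply: contraNneq vs => -[->]; rewrite inE ys orbT.
- move=> a; rewrite inE => /orP[/set1P->|/P10].
    by apply: connect1; rewrite /= inE eqxx.
  by apply: connect_sub => x y /sub; exact: connect1.
rewrite cardsU1 vA; suff : #|porbits (face_perm r')|.+1 = #|porbits (face_perm r)|.
  by move: P11; lia.
have -> : face_perm r' = face_perm r * t by rewrite /face_perm mulgA.
have pE : face_perm r ((face_perm r)^-1 (None, Some u)) = (None, Some u).
  exact: permKV.
rewrite /t -{1}pE -{1}fv mul_tpermr card_porbits_tperm_notin //.
rewrite -porbit_apply pE (porbit2 fv fv') !inE !xpair_eqE /=.
by apply: contraNneq vs => -[->]; rewrite inE eqxx.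
Qed.

(** The edge is drawn across the corner between the consecutive spokes to [u] and [v], and cuts the
    triangle [None], [u], [v] off the face there. The two new darts first formed a non-dart orbit:
    merging it into that face loses one orbit, and splitting off the triangle regains one. The last
    two conclusions record where the new darts sit, as [planar_inv_drop] requires. *)
Lemma planar_inv_edge e e' A u v s r :
    e' =2 (fun x y => e x y || ((x == u) && (y == v)) || ((x == v) && (y == u))) ->
    planar_inv e A [:: u, v & s] r -> ~~ e u v ->
  let r' := tperm (Some v, None) (Some v, Some u) * r
            * tperm (Some u, None) (Some u, Some v) in
  [/\ planar_inv e' A [:: u, v & s] r',
      r' (Some v, None) = (Some v, Some u) & r' (Some u, Some v) = (Some u, None)].
Proof.
move=> e'E; case=> P1 P2 P3 P4 P5 P6 P7 P8 P9 P10 P11 nuv.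
set t1 := tperm _ _; set t2 := tperm _ _; set r1 := t1 * r; set r' := r1 * t2 => /=.
have uv : u != v by apply: contraTneq P4 => ->; rewrite /= mem_head.
have rb : r (Some u, Some v) = (Some u, Some v) by exact: P7.
have rd : r (Some v, Some u) = (Some v, Some u) by apply: P7; rewrite /= P1.
have r1b : r1 (Some u, Some v) = (Some u, Some v).
  by rewrite permM tpermD ?rb // xpair_eqE /= (inj_eq Some_inj) eq_sym (negPf uv).
have r'c : r' (Some v, None) = (Some v, Some u).
  by rewrite !permM tpermL rd tpermD // xpair_eqE /= (inj_eq Some_inj) (negPf uv).
have r'b : r' (Some u, Some v) = (Some u, None) by rewrite permM r1b tpermR.
have r'z d : r' (None, d) = r (None, d).
  rewrite !permM [t1 _]tpermD // /t2; case: tpermP => // h;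
    by have := P6 (None, d); rewrite h.
have sub a b : star_rel e [:: u, v & s] a b -> star_rel e' [:: u, v & s] a b.
  by case: a b => [a|] [b|] //=; rewrite e'E => ->.
(* The two new darts are cut out again one at a time, by [porbit_bypass]. *)
have old p q : p \notin [:: (Some u, Some v); (Some v, Some u)] ->
    q \notin [:: (Some u, Some v); (Some v, Some u)] ->
    q \in porbit r p -> q \in porbit r' p.
  rewrite !inE !negb_or => /andP[pb pd] /andP[qb qd].
  rewrite -(porbit_bypass (y := (Some v, Some u)) (r := r1)) //; last first.
    by move=> d; exact: bypass_insl.
  rewrite -(porbit_bypass (y := (Some u, Some v)) (r := r')) // => d.
  exact: bypass_insr.
split=> //; split=> //.
- by move=> x y; rewrite !e'E P1 -!orbA; congr (_ || _); rewrite orbC !(andbC (x == _)).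
- move=> x; rewrite e'E P2 /=; case: eqP => [->|_] /=; first by rewrite (negPf uv).
  exact: andbF.
- move=> x y; rewrite e'E => /orP[/orP[/P3//|]|] /andP[/eqP-> _]; apply: P5;
  by rewrite !inE eqxx ?orbT.
- move=> d; rewrite !permM; set d' := t1 d.
  have -> : d.1 = d'.1 by rewrite /d' /t1; case: tpermP => // ->.
  rewrite -[RHS]P6; case: (r d') => [a b] /=.
  by rewrite /t2; case: tpermP => // [] [-> _].
- move=> [a b] /= nd; have nd0 : ~~ star_rel e [:: u, v & s] a b by apply: contra nd => /sub.
  rewrite !permM tpermD ?P7 ?tpermD //; apply: contraNneq nd => -[<- <-] /=;
    by rewrite ?e'E ?inE ?eqxx ?orbT.
- move=> w a b wa wb.
  (* Each new dart is next to a spoke in the rotation at its source, so an old dart represents its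
     orbit. *)
  have rep c : star_rel e' [:: u, v & s] (Some w) c -> exists2 c',
      star_rel e [:: u, v & s] (Some w) c' & (Some w, c) \in porbit r' (Some w, c').
    case: c => [c|] /=; last by exists None => //; exact: porbit_id.
    rewrite e'E => /orP[/orP[wc|/andP[/eqP-> /eqP->]]|/andP[/eqP-> /eqP->]].
    + by exists (Some c) => //; exact: porbit_id.
    + exists None; first by rewrite /= inE eqxx.
      by rewrite porbit_sym -r'b porbit_apply porbit_id.
    + exists None; first by rewrite /= !inE eqxx orbT.
      by rewrite -r'c porbit_apply porbit_id.
  have nin c : star_rel e [:: u, v & s] (Some w) c ->
      (Some w, c) \notin [:: (Some u, Some v); (Some v, Some u)].
    move=> wc; rewrite !inE negb_or; apply/andP; split; apply: contraNneq nuv => -[we ce].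
      by move: wc; rewrite we ce.
    by move: wc; rewrite we ce /= P1.
  have [a' wa' aa'] := rep _ wa; have [b' wb' bb'] := rep _ wb.
  move: bb' aa'; rewrite -!eq_porbit_mem => /eqP-> /eqP->.
  by rewrite eq_porbit_mem; apply: old; rewrite ?nin //; exact: P8.
- by rewrite (eq_cycle (e' := fun x y => r (None, Some x) == (None, Some y))) // => x y;
    rewrite r'z.
- by move=> a /P10; apply: connect_sub => x y /sub; exact: connect1.
suff <- : #|porbits (face_perm r)| = #|porbits (face_perm r')| by [].
pose phi := face_perm r.
have phiE : face_perm r' = tperm (None, Some v) (Some u, Some v) * (phi * t2).
  by rewrite /phi /face_perm !mulgA -mul_tpermr !permE.
have fd : phi (Some v, Some u) = (Some u, Some v) by rewrite face_permE rb.
have fb : phi (Some u, Some v) = (Some v, Some u) by rewrite face_permE rd.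
have fa : phi (Some u, None) = (None, Some v).
  by rewrite face_permE; move: P9 => /= /andP[/eqP].
have pE : phi (phi^-1 (Some u, None)) = (Some u, None) by exact: permKV.
rewrite phiE card_porbits_tperm_in //; last first.
  have sb : (phi * t2) (Some u, Some v) = (Some v, Some u).
    by rewrite permM fb /t2 tpermD // xpair_eqE /= (inj_eq Some_inj) (negPf uv).
  have sd : (phi * t2) (Some v, Some u) = (Some u, None) by rewrite permM fd tpermR.
  have sa : (phi * t2) (Some u, None) = (None, Some v) by rewrite permM fa /t2 tpermD.
  by rewrite -sa porbit_apply -sd porbit_apply -sb porbit_apply porbit_id.
rewrite /t2 -{1}pE -{1}fd mul_tpermr card_porbits_tperm_notin //.
rewrite -porbit_apply pE (porbit2 fd fb) !inE !xpair_eqE /=.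
by rewrite !andbF.
Qed.

(** By the last two hypotheses the triangle [None], [u], [v] is a face. Deleting the spoke at [v]
    merges this triangle with the face on the other side of the spoke, while the two former darts
    become a non-dart orbit; the number of orbits stays the same. *)
Lemma planar_inv_drop e A u v s r :
    planar_inv e A [:: u, v & s] r -> e u v ->
    r (Some v, None) = (Some v, Some u) -> r (Some u, Some v) = (Some u, None) ->
  planar_inv e A (u :: s) (tperm (None, Some u) (None, Some v) * r
                           * tperm (Some v, None) (Some v, Some u)).
Proof.
case=> P1 P2 P3 P4 P5 P6 P7 P8 P9 P10 P11 euv rc rb.
set t1 := tperm _ _; set t2 := tperm _ _; set r' := t1 * r * t2.
have /= /and3P[] := P4; rewrite inE negb_or => /andP[uv us] vs s_uniq.
have sub a b : star_rel e (u :: s) a b -> star_rel e [:: u, v & s] a b.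
  by case: a b => [a|] [b|] //=; rewrite !inE => /orP[]->; rewrite ?orbT.
have r'S a d : r' (Some a, d) = (r * t2) (Some a, d) by rewrite !permM [t1 _]tpermD.
have r'z d : r' (None, d) = r (t1 (None, d)).
  rewrite !permM /t2; case: tpermP => // h;
    have := P6 (t1 (None, d)); rewrite h /t1; by case: tpermP => // [] [_ ->].
have ruz : r (None, Some u) = (None, Some v) by move: P9 => /= /andP[/eqP].
split=> //.
- by rewrite /= us.
- by move=> x; rewrite inE => /predU1P[->|xs]; apply: P5; rewrite !inE ?eqxx ?xs ?orbT.
- move=> d; rewrite !permM; set d' := t1 d.
  have -> : d.1 = d'.1 by rewrite /d' /t1; case: tpermP => // ->.
  rewrite -[RHS]P6; case: (r d') => [a b] /=.
  by rewrite /t2; case: tpermP => // [] [-> _].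
- move=> [a b] /= nd.
  have [[ea eb]|nzv] := eqVneq (a, b) (None, Some v).
    by rewrite ea eb r'z /t1 tpermR.
  have [[ea eb]|nvz] := eqVneq (a, b) (Some v, None).
    by rewrite ea eb r'S permM rc tpermR.
  have nd0 : ~~ star_rel e [:: u, v & s] a b.
    case: a b nd nzv nvz => [a|] [b|] //=; rewrite !inE xpair_eqE /= ?andbT (inj_eq Some_inj) => h.
      by move=> _ /negPf->.
    by move=> /negPf->.
  rewrite !permM [t1 _]tpermD ?P7 ?[t2 _]tpermD // 1?eq_sym //;
    apply: contraNneq nd0 => -[-> ->] /=; rewrite ?inE ?eqxx ?orbT // P1 //.
- move=> w a b wa wb.
  rewrite (@eq_in_porbit _ _ (r * t2) [set d | d.1 == Some w]); first last.
  + by rewrite inE.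
  + move=> d; rewrite !inE permM -(P6 d); case: (r d) => [? ?] /=.
    by rewrite /t2; case: tpermP => // -[-> _].
  + by move=> [? ?]; rewrite inE => /eqP/= ->; exact: r'S.
  have nin c : star_rel e (u :: s) (Some w) c -> (Some w, c) != (Some v, None).
    move=> wc; apply: contraTneq wc => -[-> ->] /=.
    by rewrite inE negb_or eq_sym uv.
  rewrite -(porbit_bypass (y := (Some v, None)) (r := r)) ?nin //.
    by apply: P8; exact: sub.
  by move=> d dy; rewrite /t2 -rc bypass_out.
- have : path.cycle (fun x y => r (None, Some x) == (None, Some y)) [:: u, v & s] by [].
  rewrite /= => /andP[_].
  have r'u : r' (None, Some u) = r (None, Some v) by rewrite r'z /t1 tpermL.
  have r'x x : x \in s -> r' (None, Some x) = r (None, Some x).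
    move=> xs; rewrite r'z /t1 tpermD // xpair_eqE /= (inj_eq Some_inj).
      by apply: contraNneq us => ->.
    by apply: contraNneq vs => ->.
  case: (s) r'x => [|y t] r'x /=; first by rewrite r'u.
  rewrite r'u !rcons_path => /andP[-> /andP[yt tu]] /=; rewrite r'x ?mem_last // tu andbT.
  apply: (sub_in_path (P := mem (y :: t))) yt; last by apply/allP.
  by move=> x' y' /= xs _; rewrite r'x.
(* Paths that used the spoke at [v] are rerouted through [u] and the edge from [u] to [v]. *)
- move=> a /P10; apply: connect_sub => x y xy.
  have zu : star_rel e (u :: s) None (Some u) by rewrite /= mem_head.
  have uv' : star_rel e (u :: s) (Some u) (Some v) by [].
  have zv : connect (star_rel e (u :: s)) None (Some v).
    by apply: connect_trans (connect1 zu) (connect1 uv').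
  have sy : connect_sym (star_rel e (u :: s)).
    by apply: sym_connect_sym; exact: star_rel_sym.
  case: x y xy => [x|] [y|] //=; rewrite ?inE.
  + by move=> xy; apply: connect1.
  + case/or3P => [/eqP->|/eqP->|xs]; rewrite sy //; apply: connect1; rewrite /= ?inE ?eqxx ?xs ?orbT //.
  + case/or3P => [/eqP->|/eqP->|xs] //; apply: connect1; rewrite /= ?inE ?eqxx ?xs ?orbT //.
suff <- : #|porbits (face_perm r)| = #|porbits (face_perm r')| by [].
pose phi := face_perm r.
have phiE : face_perm r' = tperm (Some u, None) (Some v, None) * (phi * t2).
  by rewrite /phi /face_perm !mulgA -mul_tpermr !permE.
have fa : phi (Some u, None) = (None, Some v) by rewrite face_permE.
have fc : phi (None, Some v) = (Some v, Some u) by rewrite face_permE.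
have fd : phi (Some v, Some u) = (Some u, None) by rewrite face_permE.
have pE : phi (phi^-1 (Some v, None)) = (Some v, None) by exact: permKV.
have sa : (phi * t2) (Some u, None) = (None, Some v) by rewrite permM fa /t2 tpermD.
have sc : (phi * t2) (None, Some v) = (Some v, None) by rewrite permM fc tpermR.
have uvz : (Some u, None) != (Some v, None) :> V * V.
  by rewrite xpair_eqE /= andbT (inj_eq Some_inj).
have ac : (Some u, None) \in porbit (phi * t2) (Some v, None).
  by rewrite porbit_sym -sc porbit_apply -sa porbit_apply porbit_id.
rewrite phiE card_porbits_tperm_in //.
rewrite /t2 -{1}pE -{1}fc mul_tpermr card_porbits_tperm_notin //.
rewrite -porbit_apply pE.
apply/negP => vz; set B := [set (None, Some v); (Some v, Some u); (Some u, None)] : {set V * V}.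
have Bc : {in B, forall y, phi y \in B}.
  by move=> y; rewrite !inE => /orP[/orP[]|] /eqP->; rewrite ?fa ?fc ?fd eqxx ?orbT.
have Bd : (None, Some v) \in B by rewrite !inE eqxx.
have := porbit_closed Bc Bd vz; rewrite !inE => /orP[/orP[]|] /eqP[] // e1.
by rewrite e1 eqxx in uv.
Qed.


Lemma planar_inv_dart e A s r d : planar_inv e A s r ->
  star_rel e s d.1 d.2 -> star_rel e s (r d).1 (r d).2.
Proof.
move=> pl dd; apply/negPn/negP => nd; move: (nd).
by move=> /(pi_fix pl)/perm_inj rd; rewrite rd dd in nd.
Qed.

Lemma planar_inv_is_rotation e A s r :
  planar_inv e A s r -> is_rotation (star_rel e s) r.
Proof.
move=> pl; split=> [d|[a b] [a' b']].
  by rewrite !inE => dd; split; [exact: planar_inv_dart pl dd | exact: pi_src pl d].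
rewrite !inE /= => ab a'b' aa'; rewrite -{}aa' in a'b' *.
suff /porbitP[m ->] : (a, b') \in porbit r (a, b) by exists m.
case: a ab a'b' => [a|] ab ab'; first exact: (pi_rot pl).
case: b b' ab ab' => [b|] [b'|] //= sb sb'.
have zc : fcycle r [seq (None, Some x) | x <- s] by rewrite cycle_map; exact: pi_cycle pl.
by rewrite -porbit_fconnect (fconnect_cycle zc) map_f.
Qed.

Lemma face_stepE r d : face_step r d = face_perm r d.
Proof. by case: d => a b; rewrite face_permE. Qed.

(** When [A] is everything, the graph with its apex is connected and has no isolated vertex. The
    orbits of [face_perm] are the faces together with the non-dart orbits; counting the latter by
    [card_swap_porbits] turns [pi_count] into Euler's formula. *)
Lemma planar_inv_genus0 e s r :
  s != [::] -> planar_inv e setT s r -> genus0 (star_rel e s) r.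
Proof.
move=> s0 pl; rewrite /genus0; have [P1 P2 P3 P4 P5 P6 P7 P8 P9 P10 P11] := pl.
set E := star_rel e s; pose phi := face_perm r; pose D := darts E.
have sE : symmetric E by exact: star_rel_sym.
have cV : #|{: V}| = N.+1 by rewrite card_option card_ord.
have conn a : connect E None a by case: a => [a|]; rewrite ?connect0 // P10 ?inE.
have -> : num_components E = 1%N.
  rewrite /num_components (_ : [set _ | u in _] = [set setT]) ?cards1 //.
  apply/setP => B; rewrite inE; apply/imsetP/eqP => [[u _ ->]|->].
    apply/setP => v; rewrite !inE; apply: connect_trans (conn v).
    by rewrite (sym_connect_sym sE).
  by exists None => //; apply/setP => v; rewrite !inE conn.
have -> : num_isolated E = 0%N.
  apply/eqP; rewrite cards_eq0; apply/eqP/setP => a; rewrite !inE; apply/negP => /forallP H.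
  case: a H => [a|] H; last first.
    have [x xs] : exists x, x \in s.
      by case: (s) s0 => // x t _; exists x; rewrite mem_head.
    by have := H (Some x); rewrite /E /= xs.
  have : connect E (Some a) None by rewrite (sym_connect_sym sE).
  by case/connectP => [[|b p] //= /andP[ab _] _]; have /negP := H b; apply.
have faceD : num_faces E r = #|porbit phi @: D|.
  rewrite /num_faces; congr #|pred_of_set _|; apply: eq_imset => d.
  apply/setP => d'; rewrite inE -porbit_fconnect; apply: eq_fconnect => x.
  exact: face_stepE.
have mD d : (d \in D) = E d.1 d.2 by rewrite inE.
have rD : {in D, forall d, r d \in D}.
  move=> d; rewrite !mD; apply: planar_inv_dart pl.
have phiD d : (phi d \in D) = (d \in D).
  suff H : {in D, forall d, phi d \in D}.
    apply/idP/idP => [h|/H //].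
    by have := porbit_closed H h; apply; rewrite porbit_sym porbit_apply porbit_id.
  move=> [a b] dD; rewrite face_permE; apply: rD.
  by move: dD; rewrite !mD sE; exact: id.
have nD d : d \in ~: D -> phi d = dart_swap d /\ dart_swap d \in ~: D.
  rewrite !inE => nd; have nd' : ~~ E d.2 d.1 by rewrite sE.
  by split=> //; case: d nd nd' => a b nd nd'; rewrite face_permE P7.
have diagD a : (a, a) \in ~: D.
  by rewrite !inE /=; case: (a) => //= x; rewrite P2.
have split_porbits : #|porbits phi| = #|porbit phi @: D| + #|porbit phi @: (~: D)|.
  rewrite porbitsT -(setUCr D) imsetU cardsU (_ : _ :&: _ = set0) ?cards0 ?subn0 //.
  apply/setP => O; rewrite !inE; apply/negP => /andP[/imsetP[d dD ->] /imsetP[d' d'D]].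
  move/eqP; rewrite eq_porbit_mem => dd'; move: d'D; rewrite inE => /negP; apply.
  have H : {in D, forall d, phi d \in D} by move=> x; rewrite phiD.
  by apply: (porbit_closed H dD); rewrite porbit_sym.
have cD : (#|D| + #|~: D| = N.+1 * N.+1)%N by rewrite cardsC card_prod cV.
have cnD := card_swap_porbits nD diagD.
(* Here [a] and [b] count the orbits of darts and of non-darts, [d] and [d'] the darts and the
   non-darts themselves; [b] and [d'] are eliminated. *)
have ar P a b d d' n : P.*2 + n.+1 + n.*2 = (n.+1 ^ 2 + n.+1.*2).+2 -> P = a + b ->
    d + d' = (n.+1 * n.+1)%N -> b.*2 = d' + n.+1 -> n.+1.*2 + (a + 0).*2 = (4 * 1)%N + d.
  by rewrite -mulnn; lia.
move: P11; rewrite cardsT card_ord => /ar /(_ split_porbits cD cnD).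
by rewrite faceD -[in LHS]cV.
Qed.

End Planarity.

Import Order.TTheory GRing.Theory Num.Theory.
Local Open Scope ring_scope.

(** * Perfect matchings *)

Section PerfectMatchings.
Variables (C : comNzRingType) (N : nat).
Implicit Types (w : 'I_N -> 'I_N -> C) (D : {set 'I_N}) (u v x y : 'I_N)
  (mu nu : {ffun 'I_N -> 'I_N}).

Lemma is_perfmatchP w D mu :
  reflect (forall u, if u \in D then
      [/\ mu u \in D, mu u != u, mu (mu u) = u & w u (mu u) != 0] else mu u = u)
    (is_perfmatch w D mu).
Proof.
apply: (iffP forallP) => H u; have := H u; case: ifP => _.
- by case/and4P=> ? ? /eqP.
- by move/eqP.
- by case=> ? ? -> ?; apply/and4P; split.
- by move->.
Qed.

Lemma eq_in_perfmatch_on w w' D :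
  {in D &, w =2 w'} -> perfmatch_on w D = perfmatch_on w' D.
Proof.
move=> ww; rewrite /perfmatch_on; apply: eq_big => mu.
  by apply/is_perfmatchP/is_perfmatchP => H u; have := H u;
    case: ifP => // uD [mD ? ? ?]; split=> //; rewrite ?ww // -ww.
move=> /is_perfmatchP H; apply: eq_bigr => u /andP[uD _].
by have := H u; rewrite uD => -[? _ _ _]; rewrite ww.
Qed.

Lemma perfmatch_on0 w : perfmatch_on w set0 = 1.
Proof.
rewrite /perfmatch_on (big_pred1 [ffun x => x]) => [|mu].
  by rewrite big_pred0 // => u; rewrite inE.
apply/is_perfmatchP/eqP => [H|-> u]; last by rewrite inE ffunE.
by apply/ffunP => u; have := H u; rewrite inE ffunE.
Qed.

Definition extend_matching u v mu : {ffun 'I_N -> 'I_N} :=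
  [ffun x => if x == u then v else if x == v then u else mu x].

Definition restrict_matching u v mu : {ffun 'I_N -> 'I_N} :=
  [ffun x => if (x == u) || (x == v) then x else mu x].

(** Matchings are grouped by the partner [v] of [u]; removing this pair is a bijection onto the
    matchings of the rest. *)
Lemma perfmatch_on_rec w D u : (forall x y, w x y = w y x) -> u \in D ->
  perfmatch_on w D = \sum_(v in D :\ u) w u v * perfmatch_on w (D :\ u :\ v).
Proof.
move=> w_sym uD; rewrite {1}/perfmatch_on.
rewrite (partition_big (fun mu : {ffun 'I_N -> 'I_N} => mu u) (fun v => v \in D :\ u)) /=; last first.
  by move=> mu /is_perfmatchP/(_ u); rewrite uD => -[? ? _ _]; apply/setD1P.
apply: eq_bigr => v /setD1P[vu vD].
have uv : u != v by rewrite eq_sym.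
(* A pair of weight 0 is no edge for [is_perfmatch], so its group is empty and the bijection is only
   available for nonzero weight. *)
have [w0|w0] := eqVneq (w u v) 0.
  rewrite w0 mul0r big1 // => mu /andP[/is_perfmatchP/(_ u) + /eqP muv].
  by rewrite uD muv w0 eqxx => -[].
rewrite /perfmatch_on big_distrr /=.
rewrite (reindex_onto (extend_matching u v) (restrict_matching u v)) /=; last first.
  move=> mu /andP[/is_perfmatchP H /eqP muv]; apply/ffunP=> x; rewrite !ffunE.
  case: eqP => [->|/eqP xu]; first by rewrite muv.
  case: eqP => [->|/eqP xv] //=.
  by have := H u; rewrite uD muv => -[_ _ -> _].
apply: eq_big => mu.
  apply/andP/is_perfmatchP => [[/andP[/is_perfmatchP H _] /eqP rK] x|H].
    have rx : mu x = restrict_matching u v (extend_matching u v mu) x by rewrite rK.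
    have Hx := H x; rewrite !inE; case: (eqVneq x v) => [->|xv] /=.
      by rewrite -rK ffunE eqxx orbT.
    case: (eqVneq x u) => [->|xu] /=; first by rewrite -rK ffunE eqxx.
    have emx : extend_matching u v mu x = mu x by rewrite ffunE (negPf xv) (negPf xu).
    move: Hx; rewrite emx; case: ifP => // xD [mD mx].
    have [->|mu_u] := eqVneq (mu x) u.
      by rewrite ffunE eqxx => e; rewrite e eqxx in xv.
    have [->|mu_v] := eqVneq (mu x) v.
      by rewrite ffunE eqxx (negPf vu) => e; rewrite e eqxx in xu.
    by rewrite ffunE (negPf mu_u) (negPf mu_v) => mm ww; split=> //; rewrite !inE mu_u mu_v.
  have mu_u : mu u = u by have := H u; rewrite !inE eqxx andbF.
  have mu_v : mu v = v by have := H v; rewrite !inE eqxx.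
  split; last first.
    apply/eqP/ffunP=> x; rewrite !ffunE; case: eqP => [->|_] //=.
    by case: eqP => [->|].
  have -> : extend_matching u v mu u = v by rewrite ffunE eqxx.
  rewrite eqxx andbT; apply/is_perfmatchP => x.
  rewrite !ffunE; have := H x; rewrite !inE.
  case: (eqVneq x u) => [->|xu] /=; first by rewrite uD (negPf vu) eqxx.
  case: (eqVneq x v) => [->|xv] /=; first by rewrite vD eqxx (negPf uv) w_sym.
  by case: ifP => // _ [/and3P[/negPf-> /negPf-> ?]].
move=> _; rewrite (bigID (fun x => (x == u) || (x == v))) /=; congr (_ * _).
  (* The product records a pair at its smaller endpoint, so the factor of the removed pair sits at
     [u] or at [v] according to their order. *)
  have [ltuv|ltvu|/val_inj e] := ltngtP u v; last by rewrite e eqxx in uv.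
  - rewrite (big_pred1 u) => [|x]; first by rewrite ffunE eqxx.
    rewrite ffunE [RHS]/=; case: (eqVneq x u) => [->|xu]; first by rewrite uD ltuv.
    case: (eqVneq x v) => [->|xv]; last by rewrite andbF.
    by rewrite ltnNge (ltnW ltuv) andbF.
  - rewrite (big_pred1 v) => [|x]; first by rewrite ffunE (negPf vu) eqxx w_sym.
    rewrite ffunE [RHS]/=; case: (eqVneq x u) => [->|xu].
      by rewrite ltnNge (ltnW ltvu) andbF (negPf uv).
    by case: (eqVneq x v) => [->|_]; rewrite ?vD ?ltvu ?andbF.
apply: eq_big => x; rewrite ffunE ?inE.
  case: (eqVneq x u) => [->|_]; first by rewrite !andbF.
  by case: (eqVneq x v) => [->|_]; rewrite ?andbF ?andbT.
by rewrite negb_or => /andP[_ /andP[/negPf-> /negPf->]].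
Qed.

Lemma perfmatch_on_isolated w D u : (forall x y, w x y = w y x) ->
  (forall x, w u x = 0) -> u \in D -> perfmatch_on w D = 0.
Proof.
move=> w_sym w0 uD; rewrite (perfmatch_on_rec w_sym uD) big1 // => v _.
by rewrite w0 mul0r.
Qed.

Definition add_edge w u v (c : C) x y :=
  w x y + (if ((x == u) && (y == v)) || ((x == v) && (y == u)) then c else 0).

Lemma add_edge_sym w u v c : (forall x y, w x y = w y x) ->
  forall x y, add_edge w u v c x y = add_edge w u v c y x.
Proof.
by move=> ws x y; rewrite /add_edge ws orbC (andbC (x == v)) (andbC (x == u)).
Qed.

Lemma perfmatch_on_notin_edge w D u v c : (u \notin D) || (v \notin D) ->
  perfmatch_on (add_edge w u v c) D = perfmatch_on w D.
Proof.
move=> uvD; apply: eq_in_perfmatch_on => x y xD yD; rewrite /add_edge.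
case: ifP => [|_]; last by rewrite addr0.
by case/orP=> /andP[/eqP ex /eqP ey]; rewrite -ex -ey xD yD in uvD.
Qed.

(** In the expansion at [u], the new weight only affects the term where [u] is matched to [v]; all
    other minors miss [u]. *)
Lemma perfmatch_on_add_edge w D u v c : (forall x y, w x y = w y x) -> u != v ->
  u \in D -> v \in D -> perfmatch_on (add_edge w u v c) D
    = perfmatch_on w D + c * perfmatch_on w (D :\ u :\ v).
Proof.
move=> w_sym uv uD vD; rewrite !(perfmatch_on_rec _ uD) //; last exact: add_edge_sym.
have vDu : v \in D :\ u by rewrite !inE eq_sym uv.
rewrite !(bigD1 _ vDu) /= addrAC -mulrDl {1}/add_edge !eqxx /=.
congr (_ * _ + _); first by apply: perfmatch_on_notin_edge; rewrite !inE eqxx !andbF.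
apply: eq_bigr => x /andP[/setD1P[xu xD] xv]; rewrite /add_edge eqxx (negPf xv) (negPf uv) addr0.
by rewrite perfmatch_on_notin_edge // !inE eqxx !andbF.
Qed.

End PerfectMatchings.

(** * Signatures realized by planar graphs *)

Section GraphSteps.
Variables (C : comNzRingType) (N : nat).
Implicit Types (w : 'I_N -> 'I_N -> C) (A : {set 'I_N}) (u v x y : 'I_N) (s : seq 'I_N) (B : {set 'I_N}).

Definition support w : rel 'I_N := fun x y => w x y != 0.

Lemma support_add_edge w u v c : (forall x y, w x y = w y x) -> w u v = 0 -> c != 0 ->
  support (add_edge w u v c) =2
  (fun x y => support w x y || ((x == u) && (y == v)) || ((x == v) && (y == u))).
Proof.
move=> ws w0 c0 x y; rewrite /support /add_edge -orbA.
case: (boolP (_ || _)) => [|_]; last by rewrite addr0 orbF.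
by rewrite orbT => /orP[]/andP[/eqP-> /eqP->]; rewrite ?(ws v) w0 add0r.
Qed.

Lemma planar_step_edge w A u v s r c :
    (forall x y, w x y = w y x) -> planar_inv (support w) A [:: u, v & s] r ->
    w u v = 0 -> c != 0 ->
  exists r', planar_inv (support (add_edge w u v c)) A [:: u, v & s] r'.
Proof.
move=> ws pl w0 c0.
have [|p _ _] := planar_inv_edge (support_add_edge ws w0 c0) pl; last by eexists; exact: p.
by rewrite /support w0 eqxx.
Qed.

(** Once joined to [u], the node [v] no longer needs its spoke to stay connected, so it can become
    internal. *)
Lemma planar_step_absorb w A u v s r c :
    (forall x y, w x y = w y x) -> planar_inv (support w) A [:: u, v & s] r ->
    w u v = 0 -> c != 0 ->
  exists r', planar_inv (support (add_edge w u v c)) A (u :: s) r'.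
Proof.
move=> ws pl w0 c0.
have [|p r1 r2] := planar_inv_edge (support_add_edge ws w0 c0) pl.
  by rewrite /support w0 eqxx.
eexists; apply: planar_inv_drop p _ r1 r2.
by rewrite /support /add_edge w0 !eqxx add0r.
Qed.

(** The node [v] is isolated in [w], so its partner is forced to be [x]. In [perfmatch_on_cherry]
    the choice is between [x] and [y]. *)
Lemma perfmatch_on_pendant w B v x c :
    (forall u v, w u v = w v u) -> (forall u, w v u = 0) -> v \notin B -> x != v ->
  perfmatch_on (add_edge w v x c) (v |: B) =
    if x \in B then c * perfmatch_on w (B :\ x) else 0.
Proof.
move=> ws w0 vB xv; have pm0 := perfmatch_on_isolated ws w0 (setU11 v B).
case: ifPn => xB.
  rewrite perfmatch_on_add_edge ?setU11 // 1?eq_sym // ?setU1K ?pm0 ?add0r //.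
  by rewrite inE xB orbT.
by rewrite perfmatch_on_notin_edge ?pm0 // !inE (negPf xB) (negPf xv) orbT.
Qed.

Lemma perfmatch_on_cherry w B v x y c d :
    (forall u v, w u v = w v u) -> (forall u, w v u = 0) -> v \notin B ->
    x != v -> y != v ->
  perfmatch_on (add_edge (add_edge w v x c) v y d) (v |: B) =
    (if x \in B then c * perfmatch_on w (B :\ x) else 0)
    + (if y \in B then d * perfmatch_on w (B :\ y) else 0).
Proof.
move=> ws w0 vB xv yv; have pE := perfmatch_on_pendant c ws w0 vB xv.
case: (boolP (y \in B)) => yB; last first.
  by rewrite perfmatch_on_notin_edge ?pE ?addr0 // !inE (negPf yB) (negPf yv) orbT.
rewrite perfmatch_on_add_edge ?setU11 ?pE ?setU1K //.
- by rewrite perfmatch_on_notin_edge // !inE (negPf vB) andbF.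
- exact: add_edge_sym.
- by rewrite eq_sym.
- by rewrite inE yB orbT.
Qed.

End GraphSteps.

Lemma uniq_map_inj_in (T1 T2 : eqType) (h : T1 -> T2) (s : seq T1) :
  uniq (map h s) -> {in s &, injective h}.
Proof.
elim: s => //= a s IH /andP[ha us] i j; rewrite !inE.
case/predU1P=> [->|si] /predU1P[->|sj] // e; last exact: IH.
  by rewrite e map_f in ha.
by rewrite -e map_f in ha.
Qed.

(** * Functions of the deleted wires, and the effect of each surgery on them *)

Section Realizable.
Variables (C : comNzRingType) (I : finType).
Implicit Types (s : seq I) (f g : {set I} -> C) (x y : I) (Z : {set I}).

(** The map [rho] places the wires on vertices. Membership in [Z] means that the node is deleted, as
    for a bit 1 of a signature, and [f] is only constrained on subsets of [s]. *)
Definition realizes s f (N m : nat) : Prop :=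
  exists (w : 'I_N -> 'I_N -> C) (A : {set 'I_N}) (rho : I -> 'I_N)
         (r : {perm option 'I_N * option 'I_N}),
  [/\ forall u v, w u v = w v u,
      planar_inv (support w) A (map rho s) r,
      #|A| = m &
      forall Z, {subset Z <= s} -> perfmatch_on w (A :\: rho @: Z) = f Z].

(* The number [N] of available vertices is universally quantified so that later
   steps can ask for spare ones; only [m] of them are used. *)
Definition realizable s f := exists m, forall N, (m <= N)%N -> realizes s f N m.

Lemma realizable_uniq s f : realizable s f -> uniq s.
Proof.
by case=> m /(_ m (leqnn m)) [w [A [rho [r [_ /pi_uniq /map_uniq]]]]].
Qed.

Lemma eq_realizable s f g : (forall Z, {subset Z <= s} -> f Z = g Z) ->
  realizable s f -> realizable s g.
Proof.
move=> fg [m H]; exists m => N /H [w [A [rho [r [ws pl cA fE]]]]].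
by exists w, A, rho, r; split=> // Z sZ; rewrite fE // fg.
Qed.

Lemma realizable_rot k s f : realizable s f -> realizable (rot k s) f.
Proof.
case=> m H; exists m => N /H [w [A [rho [r [ws pl cA fE]]]]].
exists w, A, rho, r; split=> // [|Z sZ]; first by rewrite map_rot; exact: planar_inv_rot.
by apply: fE => i /sZ; rewrite mem_rot.
Qed.

Lemma realizable_base x : realizable [:: x] (fun Z => (x \in Z)%:R).
Proof.
exists 1%N => -[//|N] _.
exists (fun _ _ => 0), [set ord0], (fun=> ord0), 1%g; split=> //=; last first.
- move=> Z Zx; case: (boolP (x \in Z)) => xZ.
    rewrite (_ : _ :\: _ = set0) ?perfmatch_on0 //.
    by apply/eqP; rewrite setD_eq0 sub1set; apply/imsetP; exists x.
  rewrite (perfmatch_on_isolated (u := ord0)) // !inE eqxx andbT.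
  apply/imsetP => -[y yZ _]; have := Zx y yZ; rewrite inE => /eqP yx.
  by rewrite -yx yZ in xZ.
- exact: cards1.
by apply: planar_inv_base => u v; rewrite /support eqxx.
Qed.

Section NewVertex.
Variables (N : nat) (A : {set 'I_N}) (rho : I -> 'I_N) (v : 'I_N) (x : I).
Hypothesis vA : v \notin A.

Definition relabel (i : I) := if i == x then v else rho i.

Lemma map_relabel s : x \notin s -> map relabel s = map rho s.
Proof.
move=> xs; apply/eq_in_map => i si; rewrite /relabel.
by case: eqP => // ix; rewrite -ix si in xs.
Qed.

(** The wire [x] now ends at [v]. A vertex that carried [x] before is internal and no longer removed
    with [x], hence [Z :\ x] in the first case. *)
Lemma relabel_setD Z : (forall i, i \in Z -> i != x -> rho i \in A) ->
  (v |: A) :\: relabel @: Z =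
    if x \in Z then A :\: rho @: (Z :\ x) else v |: (A :\: rho @: Z).
Proof.
move=> ZA; apply/setP => j.
have relE : (j \in relabel @: Z) = if j == v then x \in Z else j \in rho @: (Z :\ x).
  case: eqP => [->|/eqP jv].
    apply/imsetP/idP => [[i iZ]|xZ]; last by exists x; rewrite // /relabel eqxx.
    rewrite /relabel; case: eqP => [<- //|/eqP ix e].
    by have := ZA _ iZ ix; rewrite -e (negPf vA).
  apply/imsetP/imsetP => -[i iZ ji]; exists i.
  - rewrite !inE iZ andbT; apply: contraNneq jv => ix.
    by rewrite ji /relabel ix eqxx.
  - by move: ji jv; rewrite /relabel; case: eqP => // _ ->; rewrite eqxx.
  - by case/setD1P: iZ.
  - by case/setD1P: iZ => ix _; rewrite /relabel (negPf ix).
rewrite inE relE; case: (boolP (x \in Z)) => xZ; rewrite !inE.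
  by case: (eqVneq j v) => // ->; rewrite (negPf vA) andbF.
have -> : Z :\ x = Z by apply/setP => i; rewrite !inE; case: eqP => // ->; rewrite (negPf xZ).
by case: (eqVneq j v).
Qed.

End NewVertex.
(** Fewer than [N] vertices are in use, so a reserve [v] exists, and [pi_act] makes it isolated. The
    last clauses translate membership of vertices into membership of wires. *)
Lemma realizes_fresh s f N m : (m < N)%N -> realizes s f N m ->
  exists (w : 'I_N -> 'I_N -> C) (A : {set 'I_N}) (rho : I -> 'I_N)
         (r : {perm option 'I_N * option 'I_N}) (v : 'I_N),
  [/\ forall u v, w u v = w v u,
      planar_inv (support w) A (map rho s) r,
      #|A| = m,
      v \notin A /\ (forall u, w v u = 0) &
      forall Z, {subset Z <= s} ->
       [/\ perfmatch_on w (A :\: rho @: Z) = f Z,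
           (forall i, i \in s -> rho i \in A) &
           (forall i, i \in s -> (rho i \in A :\: rho @: Z) = (i \notin Z))]].
Proof.
move=> mN [w [A [rho [r [ws pl cA fE]]]]].
have [v vA] : exists v, v \notin A.
  apply/existsP; apply: contraLR mN => /existsPn AT.
  rewrite -leqNgt -cA -[N in (N <= _)%N]card_ord; apply: subset_leq_card.
  by apply/subsetP => u _; have := AT u; rewrite negbK.
exists w, A, rho, r, v; split=> //.
  by split=> // u; apply/eqP; apply: contraNT vA => /(pi_act pl).
have sA i : i \in s -> rho i \in A by move=> /(map_f rho) /(pi_sub pl).
move=> Z sZ; split=> // [|i si]; first exact: fE.
rewrite inE sA // andbT; congr (~~ _); apply/imsetP/idP => [[j jZ]|iZ]; last by exists i.
by move/(uniq_map_inj_in (pi_uniq pl)) => -> //; exact: sZ.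
Qed.

Lemma setD_relabel1 N (A : {set 'I_N}) (rho : I -> 'I_N) x Z :
  A :\: rho @: Z :\ rho x = A :\: rho @: (x |: Z).
Proof. by rewrite imsetU1 setDDl setUC. Qed.

(** The new node has no edge, so it spoils every matching unless it is deleted. *)
Lemma realizable_leaf x y s f : realizable (y :: s) f -> x \notin y :: s ->
  realizable [:: x, y & s] (fun Z => if x \in Z then f (Z :\ x) else 0).
Proof.
move=> [m H] xs; exists m.+1 => N mN.
have [w [A [rho [r [v [ws pl cA [vA w0] fE]]]]]] := realizes_fresh mN (H N (ltnW mN)).
exists w, (v |: A), (relabel rho v x), (r * tperm (None, Some (rho y)) (None, Some v))%g.
split=> //.
- rewrite map_cons map_relabel // {1}/relabel eqxx; exact: planar_inv_leaf.
- by rewrite cardsU1 vA cA.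
move=> Z sZ; rewrite relabel_setD // => [|i /sZ]; last first.
  rewrite inE => /predU1P[->|si _]; first by rewrite eqxx.
  by have [|_ -> //] := fE set0; move=> ?; rewrite inE.
case: ifPn => xZ; last by apply: (perfmatch_on_isolated ws w0); rewrite setU11.
have [|-> _ _ //] := fE (Z :\ x).
by move=> i /setD1P[ix /sZ]; rewrite inE (negPf ix).
Qed.

(** A fresh vertex joined to the old node of [x] by an edge of weight [c] takes over the wire. If it
    is present it must use up the old node; if it is deleted the old node stays. *)
Lemma realizable_flip c x s f : c != 0 -> realizable (x :: s) f ->
  realizable (x :: s) (fun Z => if x \in Z then f (Z :\ x) else c * f (x |: Z)).
Proof.
move=> c0 xs_f; have /= /andP[xs us] := realizable_uniq xs_f.
have [m H] := xs_f; exists m.+1 => N mN.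
have [w [A [rho [r [v [ws pl cA [vA w0] fE]]]]]] := realizes_fresh mN (H N (ltnW mN)).
have [|_ rA _] := fE set0; first by move=> i; rewrite inE.
have xv : rho x != v by apply: contraNneq vA => <-; rewrite rA ?mem_head.
have [r' pl'] := planar_step_absorb ws (planar_inv_leaf pl vA) (w0 (rho x)) c0.
exists (add_edge w v (rho x) c), (v |: A), (relabel rho v x), r'; split.
- exact: add_edge_sym.
- by rewrite map_cons map_relabel // {1}/relabel eqxx.
- by rewrite cardsU1 vA cA.
move=> Z sZ; rewrite relabel_setD // => [|i /sZ/rA //].
case: ifPn => xZ.
  rewrite perfmatch_on_notin_edge ?inE ?(negPf vA) ?andbF //.
  by have [|-> _ _ //] := fE (Z :\ x); move=> i /setD1P[_ /sZ].
have [_ _ memE] := fE _ sZ.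
rewrite perfmatch_on_pendant // ?inE ?(negPf vA) ?andbF //.
rewrite -[_ && _]in_setD memE ?mem_head // xZ setD_relabel1; congr (_ * _).
by have [|-> _ _ //] := fE (x |: Z); move=> i; rewrite !inE => /predU1P[->|/sZ];
  rewrite ?eqxx ?inE.
Qed.

(** As for [realizable_flip], but the fresh vertex is also joined to the node of [y], which remains
    external; when present it uses up one of the two. *)
Lemma realizable_fork c x y s f : realizable [:: x, y & s] f ->
  realizable [:: x, y & s] (fun Z => if x \in Z then f (Z :\ x)
    else f (x |: Z) + (if y \in Z then 0 else c * f (y |: Z))).
Proof.
(* An edge of weight 0 cannot be drawn; the fork is then a plain flip. *)
move=> xs_f; have [->|c0] := eqVneq c 0.
  apply: eq_realizable (realizable_flip (oner_neq0 C) xs_f) => Z _ /=.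
  by rewrite mul0r if_same addr0 mul1r.
have /= /and3P[xs ys us] := realizable_uniq xs_f.
have [m H] := xs_f; exists m.+1 => N mN.
have [w [A [rho [r [v [ws pl cA [vA w0] fE]]]]]] := realizes_fresh mN (H N (ltnW mN)).
have [|_ rA rxE] := fE [set x]; first by move=> i; rewrite inE => /eqP->; exact: mem_head.
have sx : x \in [:: x, y & s] by exact: mem_head.
have sy : y \in [:: x, y & s] by rewrite !inE eqxx orbT.
have xv : rho x != v by apply: contraNneq vA => <-; rewrite rA.
have yv : rho y != v by apply: contraNneq vA => <-; rewrite rA.
have yx : rho y != rho x.
  have := rxE y sy; rewrite imset_set1 !inE rA // andbT => ->.
  by apply: contraNneq xs => ->; exact: mem_head.
have [r1 pl1] := planar_step_absorb ws (planar_inv_leaf pl vA) (w0 (rho x)) (oner_neq0 C).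
have w1 : add_edge w v (rho x) 1 v (rho y) = 0.
  by rewrite /add_edge w0 eqxx (negPf yx) eq_sym (negPf xv) addr0.
have [r2 pl2] := planar_step_edge (add_edge_sym _ _ _ ws) pl1 w1 c0.
exists (add_edge (add_edge w v (rho x) 1) v (rho y) c), (v |: A), (relabel rho v x), r2; split.
- by do 2 apply: add_edge_sym.
- by rewrite map_cons map_relabel // {1}/relabel eqxx.
- by rewrite cardsU1 vA cA.
move=> Z sZ; rewrite relabel_setD // => [|i /sZ/rA //].
case: ifPn => xZ.
  rewrite !perfmatch_on_notin_edge ?inE ?(negPf vA) ?andbF //.
  by have [|-> _ _ //] := fE (Z :\ x); move=> i /setD1P[_ /sZ].
have [_ _ memE] := fE _ sZ.
have vB : v \notin A :\: rho @: Z by rewrite inE (negPf vA) andbF.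
rewrite perfmatch_on_cherry //.
rewrite !memE // xZ !setD_relabel1 mul1r; congr (_ + _).
  by have [|-> _ _ //] := fE (x |: Z); move=> i; rewrite !inE => /predU1P[->|/sZ];
    rewrite ?eqxx ?inE.
case: (y \in Z) => //=; congr (_ * _).
by have [|-> _ _ //] := fE (y |: Z); move=> i; rewrite !inE => /predU1P[->|/sZ];
  rewrite ?eqxx ?orbT ?inE.
Qed.

(** The fresh vertex is joined to the nodes of [x] and [y] and absorbs both. *)
Lemma realizable_merge x y s f : realizable [:: x, y & s] f ->
  realizable (x :: s) (fun Z => if x \in Z then f (Z :\ x) else f (x |: Z) + f (y |: Z)).
Proof.
move=> xs_f; have c0 := oner_neq0 C.
have /= /and3P[xs ys us] := realizable_uniq xs_f.
have [m H] := xs_f; exists m.+1 => N mN.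
have [w [A [rho [r [v [ws pl cA [vA w0] fE]]]]]] := realizes_fresh mN (H N (ltnW mN)).
have [|_ rA rxE] := fE [set x]; first by move=> i; rewrite inE => /eqP->; exact: mem_head.
have sx : x \in [:: x, y & s] by exact: mem_head.
have sy : y \in [:: x, y & s] by rewrite !inE eqxx orbT.
have xv : rho x != v by apply: contraNneq vA => <-; rewrite rA.
have yv : rho y != v by apply: contraNneq vA => <-; rewrite rA.
have yx : rho y != rho x.
  have := rxE y sy; rewrite imset_set1 !inE rA // andbT => ->.
  by apply: contraNneq xs => ->; exact: mem_head.
have [r1 pl1] := planar_step_absorb ws (planar_inv_leaf pl vA) (w0 (rho x)) c0.
have w1 : add_edge w v (rho x) 1 v (rho y) = 0.
  by rewrite /add_edge w0 eqxx (negPf yx) eq_sym (negPf xv) addr0.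
have [r2 pl2] := planar_step_absorb (add_edge_sym _ _ _ ws) pl1 w1 c0.
exists (add_edge (add_edge w v (rho x) 1) v (rho y) 1), (v |: A), (relabel rho v x), r2; split.
- by do 2 apply: add_edge_sym.
- rewrite map_cons map_relabel ?{1}/relabel ?eqxx //.
  by apply: contra xs; rewrite inE orbC => ->.
- by rewrite cardsU1 vA cA.
move=> Z sZ'; have sZ : {subset Z <= [:: x, y & s]}.
  by move=> i /sZ'; rewrite !inE => /orP[]->; rewrite ?orbT.
rewrite relabel_setD // => [|i /sZ/rA //].
case: ifPn => xZ.
  rewrite !perfmatch_on_notin_edge ?inE ?(negPf vA) ?andbF //.
  by have [|-> _ _ //] := fE (Z :\ x); move=> i /setD1P[_ /sZ].
have yZ : y \notin Z.
  apply: contra xs => /sZ'; rewrite inE (negPf ys) orbF => /eqP->; exact: mem_head.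
have [_ _ memE] := fE _ sZ.
have vB : v \notin A :\: rho @: Z by rewrite inE (negPf vA) andbF.
rewrite perfmatch_on_cherry //.
rewrite !memE // xZ yZ !setD_relabel1 !mul1r; congr (_ + _).
  by have [|-> _ _ //] := fE (x |: Z); move=> i; rewrite !inE => /predU1P[->|/sZ];
    rewrite ?eqxx ?inE.
by have [|-> _ _ //] := fE (y |: Z); move=> i; rewrite !inE => /predU1P[->|/sZ];
  rewrite ?eqxx ?orbT ?inE.
Qed.

End Realizable.

(** * Planar gates *)

Section Gates.
Variables (C : comNzRingType) (I : finType).
Implicit Types (s : seq I) (f g : {set I} -> C) (x y : I) (Z : {set I}).

Lemma realizable_unrot k s f : realizable (rot k s) f -> realizable s f.
Proof.
by move/(realizable_rot (size (rot k s) - k)); rewrite -/(rotr k _) rotK.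
Qed.

Lemma realizable_relabel (h h' : I -> I) s f : cancel h h' -> cancel h' h ->
  realizable s f -> realizable (map h s) (fun Z => f (h' @: Z)).
Proof.
move=> hK h'K [m H]; exists m => N /H [w [A [rho [r [ws pl cA fE]]]]].
exists w, A, (rho \o h'), r; split=> // [|Z sZ].
  by rewrite -map_comp (eq_map (_ : _ =1 rho)) // => i /=; rewrite hK.
rewrite imset_comp; apply: fE => _ /imsetP[i /sZ/mapP[j js ->] ->].
by rewrite hK.
Qed.

(* Away from the two wires [x] and [y], [Z] is a spectator: gates act on the
   bits [a] and [b] only. *)
Definition set_bits x y Z (a b : bool) : {set I} :=
  [set i | if i == x then a else if i == y then b else i \in Z].

Lemma set_bits_id x y Z : set_bits x y Z (x \in Z) (y \in Z) = Z.
Proof. by apply/setP=> i; rewrite inE; case: eqP => [->//|_]; case: eqP => [->|]. Qed.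

Lemma set_bitsE x y : x != y ->
  ((forall Z a b, x \in set_bits x y Z a b = a)
 * (forall Z a b, y \in set_bits x y Z a b = b))
 * ((forall Z a b, x |: set_bits x y Z a b = set_bits x y Z true b)
 * (forall Z a b, y |: set_bits x y Z a b = set_bits x y Z a true))
 * ((forall Z a b, set_bits x y Z a b :\ x = set_bits x y Z false b)
 * (forall Z a b, set_bits x y Z a b :\ y = set_bits x y Z a false)).
Proof.
move=> /negPf xy; have yx : (y == x) = false by rewrite eq_sym.
do ![split] => Z a b; first [apply/setP=> i | idtac]; rewrite !inE ?eqxx ?yx //;
  by case: (eqVneq i x) => [e|ix]; rewrite ?e ?xy //; case: (eqVneq i y).
Qed.

Ltac gate_bits Z x y nxy :=
  rewrite -[Z](set_bits_id x y); case: (x \in Z); case: (y \in Z);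
  rewrite !(set_bitsE nxy) /=; ring.

Lemma realizable_pair x y s f : realizable [:: x, y & s] f -> x != y.
Proof. by move/realizable_uniq => /= /andP[]; rewrite inE negb_or => /andP[]. Qed.

Lemma realizable_scale c x s f : c != 0 -> realizable (x :: s) f ->
  realizable (x :: s) (fun Z => if x \in Z then f Z else c * f Z).
Proof.
move=> c0 /(realizable_flip (oner_neq0 C))/(realizable_flip c0).
apply: eq_realizable => Z _; rewrite !inE !eqxx /= mul1r.
by case: ifP => xZ; [rewrite setD1K | rewrite setU1K ?xZ].
Qed.

(** This is the effect of an edge of weight [c] between [x] and [y]. Building it on fresh vertices
    allows any [c] and any number of repetitions, with no conflict with an existing edge. *)
Lemma realizable_pair_term c x y s f : realizable [:: x, y & s] f ->
  realizable [:: x, y & s] (fun Z => f Z +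
    (if (x \notin Z) && (y \notin Z) then c * f (x |: (y |: Z)) else 0)).
Proof.
move=> sf; have nxy := realizable_pair sf.
apply: eq_realizable (realizable_fork c (realizable_flip (oner_neq0 C) sf)) => Z _ /=.
gate_bits Z x y nxy.
Qed.

(** Conjugation by a flip of [x] turns pair creation into hopping; [realizable_hop_back] conjugates
    by a flip of [y] instead. *)
Lemma realizable_hop c x y s f : realizable [:: x, y & s] f ->
  realizable [:: x, y & s] (fun Z => f Z +
    (if (x \in Z) && (y \notin Z) then c * f (y |: (Z :\ x)) else 0)).
Proof.
move=> sf; have nxy := realizable_pair sf.
have := realizable_flip (oner_neq0 C) sf.
move/(realizable_pair_term c)/(realizable_flip (oner_neq0 C)).
by apply: eq_realizable => Z _; gate_bits Z x y nxy.
Qed.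

Lemma realizable_flip2 x y s f : realizable [:: x, y & s] f ->
  realizable [:: x, y & s] (fun Z => if y \in Z then f (Z :\ y) else f (y |: Z)).
Proof.
move/(realizable_rot 1); rewrite rot1_cons => /(realizable_flip (oner_neq0 C)) sf.
apply: (@realizable_unrot 1); rewrite rot1_cons; apply: eq_realizable sf => Z _.
by rewrite mul1r.
Qed.

Lemma realizable_hop_back c x y s f : realizable [:: x, y & s] f ->
  realizable [:: x, y & s] (fun Z => f Z +
    (if (x \notin Z) && (y \in Z) then c * f (x |: (Z :\ y)) else 0)).
Proof.
move=> sf; have nxy := realizable_pair sf.
have := realizable_flip2 (realizable_pair_term c (realizable_flip2 sf)).
by apply: eq_realizable => Z _; gate_bits Z x y nxy.
Qed.

(* The shears [hop 1], [hop_back (-1)], [hop 1] compose to the rotation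
   (p, q) -> (q, -p) of the one-particle block; scaling turns it into the
   fermionic swap. *)
Lemma realizable_swap x y s f : realizable [:: x, y & s] f ->
  realizable [:: y, x & s]
    (fun Z => if (x \notin Z) && (y \notin Z) then - f Z else f Z).
Proof.
move=> sf; have nxy := realizable_pair sf.
have N1 : -1 != 0 :> C by rewrite oppr_eq0 oner_neq0.
have := realizable_scale N1 (realizable_hop 1 (realizable_hop_back (-1) (realizable_hop 1 sf))).
move/(realizable_relabel (@tpermK _ x y) (@tpermK _ x y)).
have /and3P[] := realizable_uniq sf; rewrite inE negb_or => /andP[_ xs] ys us.
have -> : map (tperm x y) [:: x, y & s] = [:: y, x & s].
  rewrite /= tpermL tpermR; congr [:: _, _ & _]; apply: map_id_in => i si.
  by rewrite tpermD //; [apply: contraNneq xs | apply: contraNneq ys] => ->.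
apply: eq_realizable => Z _.
have -> : tperm x y @: Z = set_bits x y Z (y \in Z) (x \in Z).
  apply/setP=> i; rewrite -[i in LHS](tpermK x y) (mem_imset _ _ perm_inj) inE.
  case: (eqVneq i x) => [->|ix]; first by rewrite tpermL.
  case: (eqVneq i y) => [->|iy]; first by rewrite tpermR.
  by rewrite tpermD 1?eq_sym.
rewrite -[in RHS](set_bits_id x y Z); case: (x \in Z); case: (y \in Z);
  rewrite !(set_bitsE nxy) /=; ring.
Qed.

(** The node [y] becomes internal and always present. Merging alone would add a term with [y]
    deleted instead of [x]; the hop of weight -1 cancels it in advance, and the flip undoes the
    inversion of [x] caused by the merge. *)
Lemma realizable_forget x y s f : realizable [:: x, y & s] f ->
  realizable (x :: s) f.
Proof.
move=> sf; have nxy := realizable_pair sf.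
have := realizable_flip (oner_neq0 C) (realizable_merge (realizable_hop (-1) sf)).
have /and3P[_ ys _] := realizable_uniq sf.
apply: eq_realizable => Z sZ; have yZ : y \in Z = false.
  by apply/negP => /sZ; rewrite inE (negPf ys) eq_sym (negPf nxy).
rewrite -[Z](set_bits_id x y) yZ; case: (x \in Z); rewrite !(set_bitsE nxy) /=; ring.
Qed.

(** Both states of [y] are summed, and deleting [y] toggles [x]: the wire [x] accumulates the parity
    of the number of deletions. *)
Lemma realizable_sum x y s f : realizable [:: x, y & s] f ->
  realizable (x :: s) (fun Z => f Z +
    f (y |: (if x \in Z then Z :\ x else x |: Z))).
Proof.
move=> sf; have nxy := realizable_pair sf.
have := realizable_flip (oner_neq0 C) (realizable_merge (realizable_pair_term 1 sf)).
have /and3P[_ ys _] := realizable_uniq sf.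
apply: eq_realizable => Z sZ; have yZ : y \in Z = false.
  by apply/negP => /sZ; rewrite inE (negPf ys) eq_sym (negPf nxy).
rewrite -[Z](set_bits_id x y) yZ; case: (x \in Z); rewrite !(set_bitsE nxy) /=; ring.
Qed.

End Gates.

(** * Pfaffians *)

Section PfaffianExpansion.
Variable C : comNzRingType.

Lemma lift_perm_bij n :
  bijective (fun p : 'I_n.+1 * 'S_n => lift_perm ord0 p.1 p.2).
Proof.
apply: inj_card_bij => [[i s] [j t] /= e|]; last first.
  by rewrite card_prod card_ord !card_Sn factS.
have ij : i = j by rewrite -(lift_perm_id ord0 i s) e lift_perm_id.
congr pair; first by []; apply/permP => k.
by apply: (@lift_inj _ i); rewrite {2}ij -!(lift_perm_lift ord0) e.
Qed.

Lemma sum_lift_perm n (P : pred 'S_n.+1) (F : 'S_n.+1 -> C) :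
  \sum_(s | P s) F s =
  \sum_(i < n.+1) \sum_(s | P (lift_perm ord0 i s)) F (lift_perm ord0 i s).
Proof.
rewrite (reindex _ (onW_bij _ (@lift_perm_bij n))) /=.
by rewrite (pair_big_dep xpredT (fun i s => P (lift_perm ord0 i s))
  (fun i s => F (lift_perm ord0 i s))).
Qed.

Lemma ltn_lift n (h : 'I_n.+1) (i j : 'I_n) : (lift h i < lift h j)%N = (i < j)%N.
Proof. by rewrite !ltnNge leq_bump2. Qed.

Lemma pf_ev0 m : pf_ev (ord0 : 'I_(m.+2)./2) = ord0.
Proof. exact: val_inj. Qed.

Lemma pf_od0 m : pf_od (ord0 : 'I_(m.+2)./2) = lift ord0 ord0.
Proof. exact: val_inj. Qed.

Lemma pf_ev_lift m (k : 'I_m./2) :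
  pf_ev (lift ord0 k : 'I_(m.+2)./2) = lift ord0 (lift ord0 (pf_ev k)).
Proof. exact: val_inj. Qed.

Lemma pf_od_lift m (k : 'I_m./2) :
  pf_od (lift ord0 k : 'I_(m.+2)./2) = lift ord0 (lift ord0 (pf_od k)).
Proof. exact: val_inj. Qed.

(** The value 0 cannot be second in its pair, being smaller than the first, nor open a later pair,
    being smaller than the first entry. *)
Lemma pf_admissible0 m (s : 'S_m.+2) : ~~ odd m -> pf_admissible s -> s ord0 = ord0.
Proof.
move=> em /andP[/forallP evod /forallP evev].
pose p := (s^-1)%g ord0; have sp : s p = ord0 by rewrite /p permKV.
have kP : (p./2 < (m.+2)./2)%N by have := ltn_ord p; lia.
pose k : 'I_(m.+2)./2 := Ordinal kP.
case: (boolP (odd p)) => op.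
  have pk : p = pf_od k by apply: val_inj => /=; lia.
  by have := evod k; rewrite -pk sp.
have pk : p = pf_ev k by apply: val_inj => /=; lia.
have [k0|k0] := posnP k.
  by rewrite -[RHS]sp; congr (s _); rewrite pk; apply: val_inj; move: k0 => /= ->.
by have /forallP/(_ k)/implyP := evev ord0; rewrite -pk sp => /(_ k0).
Qed.

Lemma pf_admissible_lift m (j : 'I_m.+1) (s : 'S_m) :
  pf_admissible (lift_perm ord0 ord0 (lift_perm ord0 j s)) = pf_admissible s.
Proof.
set t := lift_perm _ _ _.
have t0 : t ord0 = ord0 by exact: lift_perm_id.
have tl k : t (lift ord0 (lift ord0 k)) = lift ord0 (lift j (s k)).
  by rewrite !lift_perm_lift.
apply/andP/andP => -[/forallP evod /forallP evev]; split; apply/forallP => k.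
- by have := evod (lift ord0 k); rewrite pf_ev_lift pf_od_lift !tl !ltn_lift.
- apply/forallP => k'; have /forallP/(_ (lift ord0 k')) := evev (lift ord0 k).
  by rewrite ltn_lift !pf_ev_lift !tl !ltn_lift.
- case: (unliftP (ord0 : 'I_(m./2).+1) k) => [k1|] ->.
    by rewrite pf_ev_lift pf_od_lift !tl !ltn_lift.
  by rewrite pf_ev0 pf_od0 t0 lift_perm_lift.
apply/forallP => k'; apply/implyP.
case: (unliftP (ord0 : 'I_(m./2).+1) k') => [k1|] -> //.
case: (unliftP (ord0 : 'I_(m./2).+1) k) => [k2|] ->.
  rewrite ltn_lift !pf_ev_lift !tl !ltn_lift; apply/implyP.
  by have /forallP := evev k2; apply.
by rewrite pf_ev_lift pf_ev0 tl t0.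
Qed.

(** Admissible permutations fix 0 and are sorted by the partner [lift ord0 j] of 0; the rest is an
    arbitrary admissible permutation of the minor, and the lift contributes the sign. *)
Lemma pfaffian_expand_row m (A : 'M[C]_m.+2) :
  pfaffian A = \sum_(j < m.+1) (-1) ^+ j * A ord0 (lift ord0 j) *
    pfaffian (\matrix_(i, k) A (lift ord0 (lift j i)) (lift ord0 (lift j k))).
Proof.
rewrite /pfaffian /= negbK; case: ifPn => [_|em].
  by rewrite big1 // => j _; rewrite mulr0.
rewrite sum_lift_perm big_ord_recl [X in _ + X]big1 ?addr0 => [|i _]; last first.
  rewrite big_pred0 // => s; apply/negP => /(pf_admissible0 em).
  by rewrite lift_perm_id.
rewrite sum_lift_perm; apply: eq_bigr => j _; rewrite big_distrr /=.
apply: eq_big => [s|s _]; first exact: pf_admissible_lift.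
rewrite !odd_lift_perm /= signr_addb signr_odd -!mulrA; congr (_ * _).
rewrite mulrCA; congr (_ * _); rewrite big_ord_recl; congr (_ * _).
  by rewrite pf_ev0 pf_od0 lift_perm_id lift_perm_lift lift_perm_id.
by apply: eq_bigr => k _; rewrite mxE pf_ev_lift pf_od_lift !lift_perm_lift.
Qed.

End PfaffianExpansion.

(** * Pfaffians from a travelling wire *)

Section PfaffianState.
Variables (C : comNzRingType) (I : finType) (M : I -> I -> C).
Implicit Types (l p s : seq I) (x y : I) (Z : {set I}).

(** Indexing by a list makes the deletion of vertices a [filter]. *)
Definition pf_seq l : C :=
  pfaffian (\matrix_(i < size l, j < size l) M (tnth (in_tuple l) i) (tnth (in_tuple l) j)).

Lemma pf_seqE x m (t : 'I_m -> I) l : size l = m ->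
  (forall i, t i = nth x l i) ->
  pfaffian (\matrix_(i, j) M (t i) (t j)) = pf_seq l.
Proof.
move=> e; subst m => tE; congr pfaffian; apply/matrixP => i j.
by rewrite !mxE !(tnth_nth x) !tE.
Qed.

(** The alternating first-row expansion, written as a recursion that follows the travelling wire;
    [pre] holds the entries already passed, which remain in every later minor. *)
Fixpoint row_expansion x (g : seq I -> C) pre l : C :=
  if l is y :: l' then M x y * g (pre ++ l') - row_expansion x g (rcons pre y) l' else 0.

Lemma row_expansionE x x0 g pre l : row_expansion x g pre l =
  \sum_(j < size l) (-1) ^+ j * M x (nth x0 l j) * g (pre ++ take j l ++ drop j.+1 l).
Proof.
elim: l pre => [|y l IH] pre; first by rewrite big_ord0.
rewrite /= big_ord_recl /= expr0 mul1r drop0 IH -sumrN; congr (_ + _).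
apply: eq_bigr => j _; rewrite -cats1 -catA /= exprS !mulNr mul1r; congr (- (_ * g _)).
Qed.

Lemma pf_seq_nil : pf_seq [::] = 1.
Proof.
rewrite /pf_seq /pfaffian /= (big_pred1 1%g) => [|s].
  by rewrite odd_perm1 expr0 mul1r big_ord0.
rewrite [RHS]/= (_ : s = 1%g) ?eqxx; last by apply/permP => -[].
by apply/andP; split; apply/forallP => -[].
Qed.

Lemma pf_seq_cons x l : pf_seq (x :: l) = row_expansion x pf_seq [::] l.
Proof.
case: l => [|y l]; first by [].
rewrite (row_expansionE _ x) [LHS]pfaffian_expand_row; apply: eq_bigr => j _.
rewrite mxE !(tnth_nth x) /=; congr (_ * _).
under eq_mx do rewrite mxE.
apply: (pf_seqE (x := x)).
  by rewrite size_cat size_take size_drop /= ltn_ord subnKC // -ltnS ltn_ord.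
move=> i; rewrite (tnth_nth x) /= nth_cat size_take /=.
have := ltn_ord j; have := ltn_ord i => /= hi hj; rewrite hj.
case: ltnP => ij; first by rewrite nth_take // /bump leqNgt ij.
by rewrite nth_drop /bump ij /=; congr nth; lia.
Qed.

(** A fermionic swap of [x] with [y], followed by a pair term of weight [M x y]. *)
Definition travel_step x y (g : {set I} -> C) Z : C :=
  if (x \notin Z) && (y \notin Z) then - g Z + M x y * g (x |: (y |: Z)) else g Z.

(** In the cyclic order [x] comes right after the end of [p], so it crosses [p] from the last entry
    to the first. *)
Lemma realizable_travel x q p (f : {set I} -> C) :
  realizable (x :: q ++ p) f ->
  realizable (x :: p ++ q) (foldr (travel_step x) f p).
Proof.
elim/last_ind: p q f => [|p y IH] q f; first by rewrite cats0.
rewrite foldr_rcons cat_rcons => sf; apply: (IH (y :: q)).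
have sf1 : realizable [:: y, x & q ++ p] f.
  by apply: (@realizable_unrot _ _ 1); rewrite rot1_cons /= rcons_cat.
apply: eq_realizable (realizable_pair_term (M x y) (realizable_swap sf1)) => Z _.
by rewrite /travel_step; case: (x \in Z); case: (y \in Z); rewrite /= ?addr0 //
  !inE !eqxx orbT.
Qed.

Lemma travel_mem x p (f : {set I} -> C) Z :
  x \in Z -> foldr (travel_step x) f p Z = f Z.
Proof. by move=> xZ; elim: p => //= y p IH; rewrite /travel_step xZ. Qed.

(** The steps do nothing once [x] is deleted, by [travel_mem]. So pairing [x] with [y] contributes
    [M x y] times the state without [y], and passing a present [y] unpaired costs one sign, which is
    the recursion of [row_expansion]. *)
Lemma foldr_travel x pre p (F : {set I} -> C) g Z :
    uniq (x :: pre ++ p) -> x \notin Z ->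
    (forall Z', F Z' = g [seq i <- pre ++ p | i \notin Z']) ->
  foldr (travel_step x) (fun Z' => if x \in Z' then F (Z' :\ x) else 0) p Z =
  row_expansion x g [seq i <- pre | i \notin Z] [seq i <- p | i \notin Z].
Proof.
move=> + xZ FE; elim: p pre FE => [|y p IH] pre FE up /=; first by rewrite (negPf xZ).
have up' : uniq (x :: rcons pre y ++ p) by rewrite cat_rcons.
have FE' Z' : F Z' = g [seq i <- rcons pre y ++ p | i \notin Z'] by rewrite cat_rcons.
rewrite {1}/travel_step xZ (IH _ FE' up') filter_rcons.
have [yZ|yZ] //= := boolP (y \in Z).
rewrite [RHS]addrC; congr (_ + M x y * _); rewrite travel_mem ?setU11 //.
have /and3P[xpre upre _] : [&& x \notin pre ++ y :: p, uniq (pre ++ y :: p) & true].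
  by rewrite andbT -cons_uniq.
have xy : x != y by apply: contraNneq xpre => ->; rewrite mem_cat mem_head orbT.
rewrite setU1K ?FE; last by rewrite !inE negb_or xy.
move: upre; rewrite cat_uniq /= negb_or => /and3P[_ /andP[ypre _] /andP[yp _]].
rewrite filter_cat /= !inE eqxx /=; congr (g (_ ++ _)); apply: eq_in_filter => i ip;
  rewrite !inE negb_or; apply: andb_idl => _.
  by apply: contraNneq ypre => <-.
by apply: contraNneq yp => <-.
Qed.

(** The wire [x] is added as an isolated node, which forces it to be deleted or paired, and travels
    once around all the others. *)
Lemma realizable_pf_seq s : s != [::] -> uniq s ->
  realizable s (fun Z => pf_seq [seq i <- s | i \notin Z]).
Proof.
elim: s => // x [|y s] IH _ us.
  apply: eq_realizable (realizable_base C x) => Z _ /=.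
  by case: (x \in Z) => /=; rewrite ?pf_seq_nil ?pf_seq_cons.
have /andP[xs us'] := us; have := realizable_leaf (IH isT us') xs.
move/(@realizable_travel x [::]); rewrite cats0.
apply: eq_realizable => Z sZ.
have [xZ|xZ] := boolP (x \in Z); last first.
  rewrite [LHS](foldr_travel (pre := [::]) (g := pf_seq)
    (F := fun Z' => pf_seq [seq i <- y :: s | i \notin Z'])) //.
  by rewrite [in RHS]/= xZ pf_seq_cons.
rewrite travel_mem // xZ.
have -> : [seq i <- [:: x, y & s] | i \notin Z] = [seq i <- y :: s | i \notin Z].
  by rewrite [LHS]/= xZ.
congr (pf_seq _); apply: eq_in_filter => i si.
by rewrite !inE; case: eqP => // ix; rewrite -ix si in xs.
Qed.

End PfaffianState.

(** * Eliminating wires *)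

Lemma next_enum_ord k (i : 'I_k) : next (enum 'I_k) i = ordS i.
Proof.
case: k i => [[] //|k] i; rewrite next_nth mem_enum inE index_enum_ord.
have [ik|ik] := eqVneq i ord_max.
  rewrite ik enum_ordSl /= nth_default; last by rewrite size_map size_enum_ord.
  by apply: val_inj; rewrite /= modnn.
have ltik : (i.+1 < k.+1)%N.
  rewrite ltnS ltn_neqAle -ltnS ltn_ord andbT.
  by apply: contraNneq ik => e; apply/eqP/val_inj.
have <- : nth ord0 (enum 'I_k.+1) i.+1 = ordS i.
  by apply: val_inj; rewrite /= nth_enum_ord // modn_small.
by rewrite enum_ordSl.
Qed.

(** Taking [N] equal to the number of used vertices leaves no reserves, so [planar_inv_genus0]
    applies. *)
Lemma pmatchgate_of_realizable (C : comNzRingType) (I : finType) k (lab : 'I_k -> I)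
    (f : {set I} -> C) : (0 < k)%N -> realizable (map lab (enum 'I_k)) f ->
  exists G : pmatchgate C k, forall alpha : 'I_k -> bool,
    signature G alpha = f (lab @: [set i | alpha i]).
Proof.
move=> k0 [N /(_ N (leqnn N)) [w [A [rho [r [ws pl cA fE]]]]]].
have AT : A = setT.
  by apply/eqP; rewrite eqEcard subsetT cardsT card_ord [in X in (_ <= X)%N]cA /=.
subst A; pose ext i := rho (lab i).
have sE : map rho (map lab (enum 'I_k)) = codom ext by rewrite -map_comp codomE.
rewrite sE in pl.
have ext_inj : injective ext by apply/injectiveP; have := pi_uniq pl.
have w_irr u : w u u = 0.
  by apply/eqP; have := pi_irr pl u; rewrite /support => /negPn.
have pln : planar_outer (fun u v => w u v != 0) ext.
  exists r; split; first exact: planar_inv_is_rotation pl.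
    apply: planar_inv_genus0 pl; apply/eqP => /(congr1 size).
    by rewrite size_codom card_ord => k00; rewrite k00 in k0.
  move=> i; have := next_cycle (pi_cycle pl) (codom_f ext i).
  by rewrite codomE next_map ?enum_uniq // next_enum_ord => /eqP.
exists (PMatchgate ws w_irr ext_inj pln) => alpha; rewrite /signature /= -fE.
  rewrite setTD -imset_comp; congr (perfmatch_on w (~: _)); apply/setP=> v.
  by apply/imsetP/imsetP => -[i ai ->]; exists i; rewrite // !inE in ai *.
by move=> _ /imsetP[i _ ->]; rewrite map_f // mem_enum.
Qed.

Lemma filter_rot (T : Type) (P : pred T) i (s : seq T) :
  filter P (rot i s) = rot (size (filter P (take i s))) (filter P s).
Proof.
have -> : filter P s = filter P (take i s) ++ filter P (drop i s).
  by rewrite -filter_cat cat_take_drop.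
by rewrite rot_size_cat /rot filter_cat.
Qed.

Section Elimination.
Variables (C : comNzRingType) (I : finType).
Implicit Types (s l t : seq I) (f g : {set I} -> C) (x y : I) (Z W B : {set I}).

(** An unwanted wire is absorbed by the kept wire [x] in front of it; a kept wire becomes the new
    head by a rotation that sends [x] to the back. *)
Lemma realizable_filter_behind (P : pred I) x l q f :
  realizable (x :: l ++ q) f -> realizable (x :: filter P l ++ q) f.
Proof.
elim: l x q => //= y l IH x q; case: ifP => _ sf; last first.
  by apply: IH; exact: realizable_forget sf.
have := realizable_rot 1 sf; rewrite rot1_cons /= rcons_cat => /IH.
rewrite -rcons_cat -cat1s => h; apply: (@realizable_unrot _ _ 1).
by rewrite rot1_cons.
Qed.

Lemma realizable_filter (P : pred I) s f :
  has P s -> realizable s f -> realizable (filter P s) f.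
Proof.
case/hasP=> x xs Px sf; case: (rot_to xs) => i l e.
have h : realizable (filter P (rot i s)) f.
  rewrite e /= Px -[filter P l]cats0; apply: realizable_filter_behind.
  by rewrite cats0 -e; exact: realizable_rot.
by apply: (@realizable_unrot _ _ (size (filter P (take i s)))); rewrite -filter_rot.
Qed.

(** The last wire of [s], a cyclic neighbour of [x], absorbs it. *)
Lemma realizable_forget_head x s f : s != [::] -> realizable (x :: s) f -> realizable s f.
Proof.
case/lastP: s => // s y _ sf; have : realizable [:: y, x & s] f.
  by apply: (@realizable_unrot _ _ 1); rewrite rot1_cons.
by move/realizable_forget/(realizable_rot 1); rewrite rot1_cons.
Qed.

Lemma big_subset_setU1 y B (F : {set I} -> C) : y \notin B ->
  \sum_(W : {set I} | W \subset y |: B) F W =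
  \sum_(W : {set I} | W \subset B) (F W + F (y |: W)).
Proof.
move=> yB; rewrite (bigID (fun W : {set I} => y \in W)) /= addrC big_split /=; congr (_ + _).
  apply: eq_bigl => W; apply/andP/idP => [[/subsetP WB yW]|WB].
    apply/subsetP => i iW; have := WB i iW; rewrite !inE => /predU1P[iy|//].
    by rewrite -iy iW in yW.
  split; first by apply: subset_trans WB _; exact: subsetUr.
  by apply: contra yB => /(subsetP WB).
rewrite (reindex_onto (fun W => y |: W) (fun W => W :\ y)) /= => [|W /andP[_ yW]]; last exact: setD1K.
apply: eq_bigl => W; rewrite setU11 andbT; apply/andP/idP => [[/subsetP WB /eqP We]|WB].
  apply/subsetP => i iW; have := WB i; rewrite !inE iW orbT => /(_ isT)/predU1P[iy|//].
  by move: iW; rewrite -We iy !inE eqxx.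
by rewrite setUS // setU1K ?eqxx //; apply: contra yB => /(subsetP WB).
Qed.

(* The pair of values of [g] with [x] present and deleted records the even and
   the odd part of the subset sum. *)
Lemma realizable_subset_sum x t q f : realizable (x :: t ++ q) f ->
  exists2 g, realizable (x :: q) g & forall Z, {subset Z <= q} ->
    g Z + g (x |: Z) =
    \sum_(W : {set I} | W \subset [set i in t]) (f (Z :|: W) + f (x |: (Z :|: W))).
Proof.
elim: t f => [|y t IH] f sf.
  exists f => // Z _; rewrite (big_pred1 set0) ?setU0 // => W.
  have -> : [set i in [::]] = set0 :> {set I} by apply/setP=> i; rewrite !inE.
  exact: subset0.
have [g sg gE] := IH _ (realizable_sum sf); exists g => // Z Zq.
have /= /andP[xtq /andP[ytq _]] := realizable_uniq sf.
have -> : [set i in y :: t] = y |: [set i in t] by apply/setP=> i; rewrite !inE.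
rewrite big_subset_setU1; last by apply: contra ytq; rewrite inE mem_cat => ->.
rewrite gE //; apply: eq_bigr => W Wt.
have xZW : x \notin Z :|: W.
  apply: contra xtq; rewrite !inE mem_cat => /orP[/Zq->|/(subsetP Wt)]; first by rewrite !orbT.
  by rewrite inE => ->; rewrite orbT.
rewrite (negPf xZW) setU11 setU1K // (setUCA Z [set y]) (setUCA [set x] [set y]).
ring.
Qed.

End Elimination.

(** * Pfaffian sums *)

Section Assembly.
Variables (C : comNzRingType) (n : nat) (w : 'I_n -> 'I_n -> C).
Implicit Types (A B S T V W : {set 'I_n}).

Lemma enum_setU_lt A B : (forall a b, a \in A -> b \in B -> (a < b)%N) ->
  enum (A :|: B) = enum A ++ enum B.
Proof.
move=> AB; pose lt (i j : 'I_n) := (i < j)%N.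
have lt_tr : transitive lt by move=> j i k; exact: ltn_trans.
have sorted_enum S : sorted lt (enum S).
  rewrite /enum_mem -enumT; apply: sorted_filter => //.
  by have := iota_ltn_sorted 0 n; rewrite -val_enum_ord sorted_map.
apply: (irr_sorted_eq lt_tr) => //.
- by move=> i; rewrite /lt ltnn.
- rewrite (sorted_pairwise lt_tr) pairwise_cat -!(sorted_pairwise lt_tr) !sorted_enum !andbT.
  by apply/allrelP => a b; rewrite !mem_enum; exact: AB.
by move=> i; rewrite mem_cat !mem_enum inE.
Qed.

Lemma sum_subset_imset (I J : finType) (h : I -> J) (S : {set I}) (F : {set J} -> C) :
  injective h ->
  \sum_(W : {set J} | W \subset h @: S) F W = \sum_(W : {set I} | W \subset S) F (h @: W).
Proof.
move=> hI; rewrite (reindex_onto (fun W : {set I} => h @: W) (fun W : {set J} => h @^-1: W)) /=.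
  apply: eq_bigl => W; have -> : h @^-1: (h @: W) = W.
    by apply/setP=> i; rewrite inE (mem_imset _ _ hI).
  rewrite eqxx andbT; apply/subsetP/idP => [hW|/(imsetS h)/subsetP //].
  by apply/subsetP => i iW; rewrite -(mem_imset _ _ hI) hW // imset_f.
move=> W /subsetP WS; apply/setP => j; apply/imsetP/idP => [|jW].
  by case=> i; rewrite inE => + ->.
by case/imsetP: (WS j jW) => i _ e; exists i; rewrite // inE -e.
Qed.

(* [None] labels the parity wire that absorbs the omittable nodes. *)
Definition label_mx (a b : option 'I_n) : C :=
  if (a, b) is (Some i, Some j) then skew_mx w i j else 0.

Lemma pf_onE S : pf_on w S = pf_seq label_mx [seq Some i | i <- enum S].
Proof.
apply: (@pf_seqE _ _ label_mx None #|S| (fun i => Some (enum_val i))) => [|i].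
  by rewrite size_map -cardE.
have iS : (i < size (enum S))%N by rewrite -cardE.
by rewrite (nth_map (enum_val i)) // -enum_val_nth.
Qed.

Lemma pf_onC V : pf_on w (~: V) =
  pf_seq label_mx [seq i <- [seq Some i | i <- enum 'I_n] | i \notin Some @: V].
Proof.
rewrite pf_onE filter_map; congr (pf_seq _ (map _ _)).
rewrite [LHS]/enum_mem -enumT; apply: eq_filter => i.
by rewrite /= (mem_imset _ _ (@Some_inj _)) -in_setC.
Qed.

(** Vertices outside [A], [T] and [B] are absorbed as always present. The wires of [T] are rotated
    to the front and folded into a new wire [None], whose two states give [f0] and [f1]. *)
Lemma realizable_pfsum A T B : A :|: B != set0 ->
    (forall a t, a \in A -> t \in T -> (a < t)%N) ->
    (forall t b, t \in T -> b \in B -> (t < b)%N) ->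
    (forall a b, a \in A -> b \in B -> (a < b)%N) ->
  exists f0 f1 : {set option 'I_n} -> C,
    [/\ realizable [seq Some i | i <- enum (A :|: B)] f0,
        realizable [seq Some i | i <- enum (A :|: B)] f1 &
        forall V, V \subset A :|: B ->
          pfsum_del w T V = f0 (Some @: V) + f1 (Some @: V)].
Proof.
move=> AB0 AT TB AB.
have [x0 x0AB] : exists x, x \in A :|: B by exact/set0Pn.
pose s0 := [seq Some i | i <- enum 'I_n].
pose F (Z : {set option 'I_n}) := pf_seq label_mx [seq i <- s0 | i \notin Z].
have s0F : realizable s0 F.
  apply: realizable_pf_seq; last by rewrite map_inj_uniq ?enum_uniq //; exact: Some_inj.
  apply/eqP => /(congr1 size)/eqP; rewrite size_map size_eq0 => /eqP e.
  by have := mem_enum 'I_n x0; rewrite e.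
pose K := A :|: (T :|: B); pose P := [pred i : option 'I_n | i \in Some @: K].
have x0K : x0 \in K by move: x0AB; rewrite !inE => /orP[]->; rewrite ?orbT.
have KE : filter P s0 = [seq Some i | i <- enum A ++ enum T ++ enum B].
  rewrite filter_map -enum_setU_lt // -enum_setU_lt; last first.
    by move=> a b aA; rewrite inE => /orP[]; [exact: AT | exact: AB].
  congr map; rewrite [RHS]/enum_mem -enumT; apply: eq_filter => i.
  by rewrite /= (mem_imset _ _ (@Some_inj _)).
have sK : realizable (filter P s0) F.
  apply: realizable_filter s0F; apply/hasP; exists (Some x0).
    by rewrite map_f // mem_enum.
  by rewrite /= imset_f.
pose Al := [seq Some i | i <- enum A]; pose Tl := [seq Some i | i <- enum T].
pose Bl := [seq Some i | i <- enum B].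
have sTBA : realizable (Tl ++ Bl ++ Al) F.
  by have := realizable_rot (size Al) sK; rewrite KE !map_cat rot_size_cat catA.
have BA0 : Bl ++ Al != [::].
  rewrite -size_eq0 size_cat !size_map -!cardE addn_eq0 !cards_eq0.
  by apply: contra AB0 => /andP[/eqP-> /eqP->]; rewrite setU0.
have notin_None (l : seq 'I_n) : None \notin [seq Some i | i <- l].
  by apply/mapP => -[].
pose leaf (Z : {set option 'I_n}) := if None \in Z then F (Z :\ None) else 0.
have sL : realizable (None :: Tl ++ (Bl ++ Al)) leaf.
  have : None \notin Tl ++ Bl ++ Al by rewrite -!map_cat.
  have : Tl ++ Bl ++ Al != [::].
    by move: BA0; rewrite -!size_eq0 !size_cat; lia.
  by case: (Tl ++ Bl ++ Al) sTBA => // y l sy _ ny; exact: realizable_leaf.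
have [g sg gE] := realizable_subset_sum sL.
have toAB f : realizable (Bl ++ Al) f -> realizable [seq Some i | i <- enum (A :|: B)] f.
  by move/(realizable_rot (size Bl)); rewrite rot_size_cat -map_cat -enum_setU_lt.
(* In both cases [None] becomes internal and present. For [f1] it is flipped first, so that presence
   then stands for its deletion in [g]. *)
exists (fun Z => g Z), (fun Z => g (None |: Z)); split.
- by apply: toAB; exact: realizable_forget_head sg.
- apply: toAB; have := realizable_forget_head BA0 (realizable_flip (oner_neq0 C) sg).
  apply: eq_realizable => Z ZBA; rewrite mul1r ifN //.
  by apply: contra (notin_None (enum B ++ enum A)) => /ZBA; rewrite map_cat.
move=> V VAB; rewrite gE; last first.
  move=> _ /imsetP[i /(subsetP VAB) + ->]; rewrite -map_cat (mem_map (@Some_inj _)).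
  by rewrite mem_cat !mem_enum inE orbC.
have -> : [set i in Tl] = Some @: T.
  by apply/setP=> [[i|]]; rewrite inE; apply/mapP/imsetP => -[j jT ->]; exists j;
    rewrite ?mem_enum // -mem_enum.
rewrite sum_subset_imset; last exact: Some_inj.
apply: eq_bigr => W _; rewrite /pf_del pf_onC -imsetU.
have nN : None \notin Some @: (V :|: W) by apply/imsetP => -[].
(* Since [leaf] vanishes while [None] is present, exactly one term per [W] remains. *)
by rewrite /leaf (negPf nN) add0r setU11 setU1K.
Qed.

End Assembly.

(** * Matchgates without external nodes *)

Section ClosedMatchgate.
Variables (C : comNzRingType) (c : C).
Hypothesis c0 : c != 0.

(* Without external nodes a single weighted edge gives any nonzero constant. *)
Definition bond (u v : 'I_2) : C := if u == v then 0 else c.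

Lemma ord2P (u : 'I_2) : u = ord0 \/ u = ord_max.
Proof. by case: u => [[|[|//]] ui]; [left | right]; apply: val_inj. Qed.

(** Here the apex is isolated, so Euler's formula is checked by hand: 3 vertices, 2 darts, 1 face, 1
    isolated vertex and 2 components. *)
Lemma planar_bond (ext : 'I_0 -> 'I_2) : planar_outer (fun u v => bond u v != 0) ext.
Proof.
set e := fun _ _ => _; pose E := aug_rel e ext.
pose a : option 'I_2 := Some ord0; pose b : option 'I_2 := Some ord_max.
have xE x : [\/ x = None, x = a | x = b].
  by case: x => [u|]; [case: (ord2P u) => ->; [constructor 2 | constructor 3] | constructor 1].
have EE x y : E x y = ((x, y) == (a, b)) || ((x, y) == (b, a)).
  have nce (u : 'I_2) : u \in codom ext = false by apply/negP => /codomP[[]].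
  have eE : forall u v : 'I_2, e u v = (u != v).
    by move=> u v; rewrite /e /bond; case: (u == v); rewrite ?eqxx ?c0.
  by case: (xE x) => ->; case: (xE y) => ->; rewrite /E /= ?nce ?eE.
have cV : #|{: option 'I_2}| = 3%N by rewrite card_option card_ord.
have dE : darts E = [set (a, b); (b, a)].
  by apply/setP => -[x y]; rewrite !inE EE.
have ab : (a, b) != (b, a) by [].
exists 1%g; split; last by case.
- split=> [d|[x y] [x' y']]; first by rewrite perm1.
  rewrite -/E !dE !inE => /orP[]/eqP[-> ->] /orP[]/eqP[-> ->] //= _; exists 0%N; by rewrite perm1.
rewrite /genus0 -/E cV dE cards2 ab.
have -> : num_isolated E = 1%N.
  rewrite /num_isolated (_ : [set _ | _] = [set None]) ?cards1 //.
  apply/setP => x; rewrite !inE; apply/forallP/eqP => [H|-> y]; last by rewrite EE.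
  by case: (xE x) H => -> // H; [have := H b | have := H a]; rewrite EE eqxx ?orbT.
have -> : num_faces E 1%g = 1%N.
  rewrite /num_faces (_ : [set _ | _ in _] = [set darts E]) ?cards1 //.
  have fE d : d \in darts E -> [set d' | fconnect (face_step 1%g) d d'] = darts E.
    move=> dd; apply/setP => d'; rewrite inE (eq_fconnect (f' := face_perm 1%g)); last first.
      by move=> z; rewrite face_stepE.
    rewrite porbit_fconnect dE.
    have sab : face_perm 1%g (a, b) = (b, a) by rewrite face_permE perm1.
    have sba : face_perm 1%g (b, a) = (a, b) by rewrite face_permE perm1.
    by move: dd; rewrite dE !inE => /orP[]/eqP->;
      [rewrite (porbit2 sab sba) | rewrite (porbit2 sba sab)]; rewrite !inE 1?orbC.
  apply/setP => S; rewrite inE; apply/imsetP/eqP => [[d dd ->]|->]; first exact: fE.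
  by exists (a, b); rewrite ?fE // dE !inE eqxx.
have -> : num_components E = 2%N.
  pose cls (x : option 'I_2) := [set v : option 'I_2 | (v == None) == (x == None)].
  have cE x : [set v | connect E x v] = cls x.
    have sE : connect_sym E by apply: sym_connect_sym => u v; rewrite !EE !xpair_eqE orbC andbC (andbC (u == a)).
    have inv u v : E u v -> (v == None) = (u == None).
      by rewrite EE => /orP[]/eqP[-> ->].
    apply/setP => v; rewrite !inE; apply/idP/eqP => [/connectP[p + ->]|].
      by elim: p x => //= y p IH x /andP[/inv <-]; exact: IH.
    have Eab : connect E a b by apply: connect1; rewrite EE eqxx.
    by case: (xE x) => ->; case: (xE v) => -> // _; rewrite ?connect0 // sE.
  rewrite /num_components (_ : [set _ | _ in _] = [set cls None; cls a]).
    rewrite cards2; suff -> : cls None != cls a by [].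
    by apply/eqP => /setP/(_ None); rewrite !inE.
  apply/setP => S; rewrite !inE; apply/imsetP/orP => [[x _ ->]|[]/eqP->].
  - rewrite cE; case: (xE x) => ->; [left | right | right]; exact/eqP.
  - by exists None.
  - by exists a.
by [].
Qed.

(** The equation on [k] allows [k] to be a cardinality such as [#|X :|: Y|]. *)
Lemma closed_matchgate k : k = 0%N ->
  exists G : pmatchgate C k, forall alpha, signature G alpha = c.
Proof.
move=> k0; subst k.
have bs u v : bond u v = bond v u by rewrite /bond eq_sym.
have bi u : bond u u = 0 by rewrite /bond eqxx.
pose ext (i : 'I_0) : 'I_2 := ord0.
have ei : injective ext by case.
exists (PMatchgate bs bi ei (planar_bond ext)) => alpha; rewrite /signature /=.
have -> : [set ext i | i in [pred i | alpha i]] = set0.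
  by apply/setP => v; rewrite inE; apply/imsetP => -[[]].
rewrite setC0 (perfmatch_on_rec bs (in_setT ord0)) (big_pred1 ord_max).
  rewrite (_ : _ :\ _ :\ _ = set0) ?perfmatch_on0 ?mulr1 //.
  by apply/setP => u; rewrite !inE; case: (ord2P u) => ->.
by move=> u; rewrite !inE; case: (ord2P u) => ->.
Qed.

End ClosedMatchgate.

Lemma map_enum_val (T : finType) (S : {set T}) :
  [seq enum_val i | i <- enum 'I_#|S|] = enum S.
Proof.
have [->|[x _]] := set_0Vmem S.
  by rewrite enum_set0; apply: size0nil; rewrite size_map size_enum_ord cards0.
apply: (@eq_from_nth _ x) => [|i]; first by rewrite size_map size_enum_ord cardE.
rewrite size_map size_enum_ord => iS; pose j := Ordinal iS.
by rewrite (nth_map j) ?size_enum_ord // (nth_ord_enum j j) (enum_val_nth x).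
Qed.

Theorem theorem8 (R : realType) (n : nat) (w : 'I_n -> 'I_n -> R[i])
  (X T Y : {set 'I_n}) :
  general_matchgate w X T Y ->
  exists G1 G2 : pmatchgate R[i] #|X :|: Y|,
    forall alpha : 'I_#|X :|: Y| -> bool,
      naked_char w X T Y alpha = signature G1 alpha + signature G2 alpha.
Proof.
move=> [_ [XT TY XY ltXT ltTY]].
have [XY0|k0] := posnP #|X :|: Y|.
  pose v := pfsum_del w T set0.
  (* The character is now the single number [v], to be split into two nonzero bond weights:
     [1 + (v - 1)], or [-1 + 2] when [v = 1]. *)
  have [c [d [c0 d0 cd]]] : exists c d : R[i], [/\ c != 0, d != 0 & c + d = v].
    have [v1|v1] := eqVneq v 1; last first.
      by exists 1, (v - 1); rewrite oner_neq0 subr_eq0 v1 subrKC.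
    by exists (-1), 2; rewrite oppr_eq0 oner_neq0 pnatr_eq0 v1; split=> //; ring.
  have [G1 G1E] := closed_matchgate c0 XY0; have [G2 G2E] := closed_matchgate d0 XY0.
  exists G1, G2 => alpha; rewrite G1E G2E cd /naked_char; congr pfsum_del.
  apply/setP => i; rewrite inE; apply/imsetP => -[j _ _].
  by case: j => j /=; rewrite XY0.
have [A [B [AB AT TB ltAB]]] : exists A B : {set 'I_n}, [/\ A :|: B = X :|: Y,
    (forall a t, a \in A -> t \in T -> (a < t)%N),
    (forall t b, t \in T -> b \in B -> (t < b)%N) &
    (forall a b, a \in A -> b \in B -> (a < b)%N)].
  (* If [T] is empty, nothing forces [X] to lie below [Y]. *)
  have [->|/set0Pn[t tT]] := eqVneq T set0.
    by exists (X :|: Y), set0; split=> [|a t|t b|a b]; rewrite ?setU0 ?inE.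
  exists X, Y; split=> // x y xX yY; exact: ltn_trans (ltXT _ _ xX tT) (ltTY _ _ tT yY).
have AB0 : A :|: B != set0 by rewrite AB -card_gt0.
have [f0 [f1 [r0 r1 fE]]] := realizable_pfsum w AB0 AT TB ltAB.
rewrite AB in r0 r1 fE.
pose lab (i : 'I_#|X :|: Y|) := Some (enum_val i).
have labE : [seq Some i | i <- enum (X :|: Y)] = map lab (enum 'I_#|X :|: Y|).
  by rewrite (map_comp Some enum_val) map_enum_val.
rewrite labE in r0 r1.
have [G1 G1E] := pmatchgate_of_realizable k0 r0.
have [G2 G2E] := pmatchgate_of_realizable k0 r1.
exists G1, G2 => alpha; rewrite G1E G2E /naked_char fE; last first.
  by apply/subsetP => _ /imsetP[i _ ->]; exact: enum_valP.
have -> : lab @: [set i | alpha i] = Some @: Z_alpha alpha; last by [].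
rewrite /Z_alpha -imset_comp; apply/setP => x; apply/imsetP/imsetP => -[i ai ->]; exists i => //;
  by rewrite !inE in ai *.
Qed.
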